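(* The class of barreled Pt\'ak spaces is the largest class $\mathcal{C}$ of ($T_0$) locally convex spaces with the following properties: (i) $\mathcal{C}$ contains all Banach spaces; (ii) $\mathcal{C}$ is closed under quotients with closed subspaces; (iii) $\mathcal{C}$ is closed under closed graphs; (iv) $\mathcal{C}$ is closed under continuous images; (v) at least one of the open-mapping property (O), the continuous-inverse property (C), the closed-graph property (G) holds for $\mathcal{C}$ (and thus all of them hold for $\mathcal{C}$). That is: the class of barreled Pt\'ak spaces satisfies (i)--(v), every class of ($T_0$) locally convex spaces satisfying (i)--(v) is contained in the class of barreled Pt\'ak spaces, and every class satisfying (i)--(v) has all three properties (O), (C), (G).
   Context: All topological vector spaces (t.v.s.) are assumed to be $T_0$ (hence Hausdorff), over the scalar field $\mathbb{R}$ or $\mathbb{C}$; l.c.s. means locally convex t.v.s. A Banach space is regarded as an l.c.s. via its norm topology. A map $u\colon E\to F$ is called closed if its graph $\mathrm{Graph}(u)=\{(e,u(e))\mid e\in E\}$ is a closed subset of $E\times F$. A map $u\colon E\to F$ is called open if for every open $O\subseteq E$ the image $u(O)$ is open in $u(E)$. A linear map $u\colon E\to F$ is called nearly-open if for each $0$-neighborhood $U\subseteq E$, $u(U)$ is dense in some $0$-neighborhood in $u(E)$ (i.e. the closure of $u(U)$ in $u(E)$ is a $0$-neighborhood in $u(E)$). For a class $\mathcal{C}$ of t.v.s. define: (O) Open-mapping property: for all $E,F$ in $\mathcal{C}$, every surjective, linear, continuous map $u\colon E\to F$ is open. (C) Continuous-inverse property: for all $E,F$ in $\mathcal{C}$,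 every bijective linear map $u\colon E\to F$ is continuous if and only if its inverse $u^{-1}$ is continuous. (G) Closed-graph property: for all $E,F$ in $\mathcal{C}$, every linear map $u\colon E\to F$ is closed if and only if it is continuous. $\mathcal{C}$ is closed under closed graphs if for all $E,F$ in $\mathcal{C}$ and every linear, closed map $u\colon E\to F$, the space $\mathrm{Graph}(u)$ (with the subspace topology from $E\times F$) is in $\mathcal{C}$. $\mathcal{C}$ is closed under quotients with closed subspaces if for every $E$ in $\mathcal{C}$ and every closed linear subspace $A$ of $E$, the quotient $E/A$ is in $\mathcal{C}$. $\mathcal{C}$ is closed under continuous images if for every $E$ in $\mathcal{C}$, every l.c.s. $F$, and every injective, linear, continuous, nearly-open map $u\colon E\to F$, the image $u(E)$ (with the subspace topology from $F$) is in $\mathcal{C}$. An l.c.s. $E$ is barreled if every barrel (closed, convex, circled, absorbing set) in $E$ is a $0$-neighborhood. Let $E'$ be the continuous dual of $E$ and $\sigma(E',E)$ the weak-* topology. An l.c.s. $E$ is a Pt\'ak space ($B$-complete) if every linear subspace $Q$ of $E'$ is $\sigma(E',E)$-closed whenever $Q\cap A$ is $\sigma(E',E)$-closed in $A$ for every equicontinuous subset $A$ of $E'$. *)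

(* Defs.v *)
From HB Require Import structures.
From mathcomp Require Import all_boot all_order all_algebra.
From mathcomp Require Import generic_quotient ring_quotient complex.
From mathcomp Require Import all_classical all_reals all_analysis.

Set Implicit Arguments.
Unset Strict Implicit.
Unset Printing Implicit Defensive.

Import Order.TTheory GRing.Theory Num.Theory.
Import numFieldTopology.Exports numFieldNormedType.Exports.

Local Open Scope classical_set_scope.
Local Open Scope ring_scope.

(* Local convexity is part of [tvsType K], but separation is not: it is stated
   separately, with [kolmogorov_space] (T0). A [tvsType] also carries
   a uniform structure, which plays no role below: every notion applied to a
   [tvsType] only involves its topology. *)

Definition real_or_complex (R : realType) (K : numFieldType) : Prop :=
  K = (R : numFieldType) \/ K = (R[i] : numFieldType).

Section SubTvs.
Context (K : numFieldType) (E : tvsType K) (A : submodClosed E).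

Definition tvs_sub : Type := {x : E | x \in A}.

HB.instance Definition _ := SubChoice.on tvs_sub.
HB.instance Definition _ := [SubChoice_isSubLmodule of tvs_sub by <:].
HB.instance Definition _ :=
  Uniform.copy tvs_sub (initial_topology (\val : tvs_sub -> E)).

Lemma tvs_sub_val_continuous : continuous (\val : tvs_sub -> E).
Proof. exact: (@initial_continuous tvs_sub E \val). Qed.

Fact tvs_sub_continuous (T : topologicalType) (f : T -> tvs_sub) :
  continuous (\val \o f : T -> E) -> continuous f.
Proof.
move=> cf x U /= [_ [[W oW <-] /= Wx] WU].
apply: (@filterS _ (nbhs x) _ (f @^-1` (\val @^-1` W))); first by move=> y /WU.
by apply: (cf x); exact: open_nbhs_nbhs.
Qed.

Fact tvs_sub_add_continuous : continuous (fun x : tvs_sub * tvs_sub => x.1 + x.2).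
Proof.
apply: tvs_sub_continuous => -[x y] /=.
apply: (@continuous_comp _ _ _ (fun z : tvs_sub * tvs_sub => (val z.1, val z.2))
   (fun z : E * E => z.1 + z.2)); last exact: add_continuous.
apply: cvg_pair => /=.
  by apply: (@cvg_comp _ _ _ fst val); [exact: cvg_fst|exact: tvs_sub_val_continuous].
by apply: (@cvg_comp _ _ _ snd val); [exact: cvg_snd|exact: tvs_sub_val_continuous].
Qed.

Fact tvs_sub_scale_continuous : continuous (fun z : K^o * tvs_sub => z.1 *: z.2).
Proof.
apply: tvs_sub_continuous => -[k y] /=.
apply: (@continuous_comp _ _ _ (fun z : K^o * tvs_sub => (z.1, val z.2))
   (fun z : K^o * E => z.1 *: z.2)); last exact: scale_continuous.
apply: (@cvg_pair _ _ _ _ (nbhs (k : K^o)) (nbhs (\val y : E))) => /=.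
  exact: cvg_fst.
by apply: (@cvg_comp _ _ _ snd val); [exact: cvg_snd|exact: tvs_sub_val_continuous].
Qed.

Fact tvs_sub_locally_convex : exists2 B : set_system tvs_sub,
  (forall b, b \in B -> convex_set b) & basis B.
Proof.
have [B Bc [Bo Bb]] := @locally_convex K E.
exists [set (\val : tvs_sub -> E) @^-1` b | b in B].
  move=> _ /[!inE] -[b /mem_set /Bc bc <-] x y l.
  rewrite !inE /= => bx by_.
  by have := bc (val x) (val y) l; rewrite !inE => /(_ bx by_).
split.
  by move=> _ [b /Bo bo <-]; apply: open_comp => // y _; exact: tvs_sub_val_continuous.
move=> x U [_ [[W oW <-] /= Wx] WU].
have [b [Bb' bx bW]] := Bb (val x) W (open_nbhs_nbhs (conj oW Wx)).
exists (\val @^-1` b); first by split => //; exists b.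
by move=> y /bW ?; exact: WU.
Qed.

HB.instance Definition _ := PreTopologicalNmodule_isTopologicalNmodule.Build
  tvs_sub tvs_sub_add_continuous.
HB.instance Definition _ := TopologicalNmodule_isTopologicalLmodule.Build
  K tvs_sub tvs_sub_scale_continuous.
HB.instance Definition _ := Uniform_isTvs.Build K tvs_sub tvs_sub_locally_convex.

End SubTvs.

Section QuotTvs.
Context (K : numFieldType) (E : tvsType K) (A : submodClosed E).

(* The quotient of a Z-module in the library is by a [zmodClosed] predicate,
   a structure that [submodClosed] does not inherit from. *)
Definition submod_pred : {pred E} := A.

Fact submod_pred_closed : zmod_closed submod_pred.
Proof.
split; first exact: (rpred0 A).
by move=> x y Ax Ay; rewrite -scaleN1r; apply: (rpredD Ax); exact: rpredZ.
Qed.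

HB.instance Definition _ := GRing.isZmodClosed.Build E submod_pred
  submod_pred_closed.

Definition tvs_quot : Type := quotient_topology (Quotient.quot submod_pred).

HB.instance Definition _ := Topological.on tvs_quot.
HB.instance Definition _ := Quotient.on tvs_quot.
HB.instance Definition _ := GRing.isZmodule.Build tvs_quot
  (@Quotient.addqA _ submod_pred) (@Quotient.addqC _ submod_pred)
  (@Quotient.add0q _ submod_pred) (@Quotient.addNq _ submod_pred).

Local Notation Q := tvs_quot.
Local Notation pi := (\pi_tvs_quot%qT : E -> Q).

Lemma tvs_quot_piD x y : pi (x + y) = pi x + pi y.
Proof. exact: (@Quotient.pi_add _ submod_pred). Qed.

Lemma tvs_quot_eq_pi x y : pi x = pi y <-> x - y \in A.
Proof.
rewrite -[X in _ <-> is_true X]/(x - y \in submod_pred) Quotient.idealrBE.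
by split=> [xy|/eqP //]; apply/eqP.
Qed.

Definition tvs_quot_scale (k : K) (x : Q) : Q := pi (k *: repr x).

Fact tvs_quot_scale_pi k x : pi (k *: x) = tvs_quot_scale k (pi x).
Proof.
by apply/tvs_quot_eq_pi; rewrite -scalerBr rpredZ//; apply/tvs_quot_eq_pi; rewrite reprK.
Qed.

Fact tvs_quot_pi_surj (x : Q) : exists y, x = pi y.
Proof. by exists (repr x); rewrite reprK. Qed.

Fact tvs_quot_scalerA a b v :
  tvs_quot_scale a (tvs_quot_scale b v) = tvs_quot_scale (a * b) v.
Proof. by have [y ->] := tvs_quot_pi_surj v; rewrite -!tvs_quot_scale_pi scalerA. Qed.

Fact tvs_quot_scale1r : left_id 1 tvs_quot_scale.
Proof. by move=> v; have [y ->] := tvs_quot_pi_surj v; rewrite -!tvs_quot_scale_pi scale1r. Qed.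

Fact tvs_quot_scalerDr : right_distributive tvs_quot_scale +%R.
Proof.
move=> a v w; have [y ->] := tvs_quot_pi_surj v; have [z ->] := tvs_quot_pi_surj w.
by rewrite -!(tvs_quot_piD, tvs_quot_scale_pi) scalerDr.
Qed.

Fact tvs_quot_scalerDl v : {morph tvs_quot_scale^~ v : a b / a + b}.
Proof. by move=> a b; have [y ->] := tvs_quot_pi_surj v; rewrite -!tvs_quot_scale_pi -tvs_quot_piD scalerDl. Qed.

HB.instance Definition _ := GRing.Zmodule_isLmodule.Build K tvs_quot
  tvs_quot_scalerA tvs_quot_scale1r tvs_quot_scalerDr tvs_quot_scalerDl.

Lemma tvs_quot_piZ k x : pi (k *: x) = k *: pi x. Proof. exact: tvs_quot_scale_pi. Qed.

Lemma tvs_quot_pi_continuous : continuous pi.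
Proof. exact: (@pi_continuous E (Quotient.quot submod_pred)). Qed.

Lemma tvs_quot_pi_open (U : set E) : open U -> open (pi @` U).
Proof.
move=> oU; rewrite /open /= /quotient_open.
suff -> : pi @^-1` (pi @` U) = \bigcup_(a in [set` A]) (fun x => x - a) @^-1` U.
  apply: bigcup_open => a _; apply: open_comp => // x _.
  apply: (@continuous_comp _ _ _ (fun y => (y, a)) (fun z : E * E => z.1 - z.2)).
    apply: (@cvg_pair _ _ _ _ (nbhs x) (nbhs a)); first exact: cvg_id.
    exact: cvg_cst.
  exact: sub_continuous.
rewrite eqEsubset; split=> [x /= [u Uu]|x [a /= Aa Uxa]].
  move/esym/tvs_quot_eq_pi => Axu; exists (x - u) => //=.
  by rewrite opprB addrC subrK.
exists (x - a) => //; apply/tvs_quot_eq_pi; rewrite addrAC subrr sub0r -scaleN1r rpredZ//.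
Qed.

Lemma tvs_quot_pi_nbhs (x : E) (U : set E) : nbhs x U -> nbhs (pi x) (pi @` U).
Proof.
rewrite nbhsE => -[V [oV Vx] VU]; apply: (@filterS _ _ _ (pi @` V)).
  exact: image_subset.
by apply: open_nbhs_nbhs; split; [exact: tvs_quot_pi_open|exists x].
Qed.

Fact tvs_quot_add_continuous : continuous (fun x : Q * Q => x.1 + x.2).
Proof.
move=> [x y]; have [{}x ->] := tvs_quot_pi_surj x; have [{}y ->] := tvs_quot_pi_surj y.
move=> U /=; rewrite -tvs_quot_piD => /tvs_quot_pi_continuous/(@add_continuous E (x, y))[[V W]] /= [Vx Wy] VW.
exists (pi @` V, pi @` W); first by split; exact: tvs_quot_pi_nbhs.
by move=> [_ _] /= [[v Vv <-] [w Ww <-]]; rewrite -tvs_quot_piD; exact: (VW (v, w)).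
Qed.

Fact tvs_quot_scale_continuous : continuous (fun z : K^o * Q => z.1 *: z.2).
Proof.
move=> [k y]; have [{}y ->] := tvs_quot_pi_surj y.
move=> U /=; rewrite -tvs_quot_piZ => /tvs_quot_pi_continuous/(@scale_continuous K E (k, y))[[V W]] /= [Vx Wy] VW.
exists (V, pi @` W); first by split => //; exact: tvs_quot_pi_nbhs.
by move=> [l _] /= [Vl [w Ww <-]]; rewrite -tvs_quot_piZ; exact: (VW (l, w)).
Qed.

Fact tvs_quot_locally_convex : exists2 B : set_system Q,
  (forall b, b \in B -> convex_set b) & basis B.
Proof.
have [B Bc [Bo Bb]] := @locally_convex K E.
exists [set pi @` b | b in B].
  move=> _ /[!inE] -[b /mem_set /Bc bc <-] y1 y2 l.
  rewrite !inE /= => -[x bx <-] [y by_ <-].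
  exists (conv l (x : convex_lmodType E) (y : convex_lmodType E)).
    by have := bc x y l; rewrite !inE; exact.
  by rewrite tvs_quot_piD !tvs_quot_piZ.
split; first by move=> _ [b /Bo bo <-]; exact: tvs_quot_pi_open.
move=> x; have [{}x ->] := tvs_quot_pi_surj x => U /tvs_quot_pi_continuous xU.
have [b [Bb' bx bU]] := Bb x _ xU.
exists (pi @` b); first by split; [exists b|exists x].
by move=> _ [y /bU Uy <-].
Qed.

HB.instance Definition _ := PreTopologicalLmod_isTvs.Build K tvs_quot
  tvs_quot_add_continuous tvs_quot_scale_continuous tvs_quot_locally_convex.
HB.instance Definition _ := PreTopologicalNmodule_isTopologicalNmodule.Build
  tvs_quot tvs_quot_add_continuous.
HB.instance Definition _ := TopologicalNmodule_isTopologicalLmodule.Build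
  K tvs_quot tvs_quot_scale_continuous.
HB.instance Definition _ := Uniform_isTvs.Build K tvs_quot tvs_quot_locally_convex.
End QuotTvs.

Section MapsAndClasses.
Context (K : numFieldType).
Implicit Types E F : tvsType K.

Definition closed_map E F (u : E -> F) : Prop :=
  closed [set p : E * F | p.2 = u p.1].

(* Images of open sets are open in the image of [u], not necessarily in [F]. *)
Definition open_map E F (u : E -> F) : Prop :=
  forall O : set E, open O -> exists2 V : set F, open V & u @` O = V `&` range u.

(* The closure of [u @` U] relative to [range u] is a neighborhood of 0 there. *)
Definition nearly_open E F (u : E -> F) : Prop :=
  forall U : set E, nbhs 0 U ->
    within (range u) (nbhs (0 : F)) (closure (u @` U)).

Section Graph.
Context (E F : tvsType K) (u : {linear E -> F}).

Definition graph_pred : {pred E * F} := [pred p | p.2 == u p.1].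

Fact graph_submod_closed : submod_closed graph_pred.
Proof.
split; first by rewrite inE /= linear0.
by move=> k p q /[!inE] /eqP pE /eqP qE /=; rewrite pE qE linearP.
Qed.

HB.instance Definition _ := GRing.isSubmodClosed.Build K (E * F)%type graph_pred
  graph_submod_closed.

Definition graph_tvs : tvsType K := tvs_sub graph_pred.

Definition image_pred : {pred F} := [pred y | y \in range u].

Fact image_submod_closed : submod_closed image_pred.
Proof.
split; first by rewrite !inE /=; exists 0; rewrite ?linear0.
move=> k x y /[!inE] -[a _ <-] [b _ <-] /=.
by exists (k *: a + b); rewrite ?linearP.
Qed.

HB.instance Definition _ := GRing.isSubmodClosed.Build K F image_pred
  image_submod_closed.

Definition image_tvs : tvsType K := tvs_sub image_pred.

End Graph.

Definition tvs_class := tvsType K -> Prop.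
Implicit Type C : tvs_class.

Definition open_mapping_property C : Prop :=
  forall E F, C E -> C F -> forall u : {linear E -> F},
    range u = setT -> continuous u -> open_map u.

Definition continuous_inverse_property C : Prop :=
  forall E F, C E -> C F -> forall (u : {linear E -> F}) (v : F -> E),
    cancel u v -> cancel v u -> (continuous u <-> continuous v).

Definition closed_graph_property C : Prop :=
  forall E F, C E -> C F -> forall u : {linear E -> F},
    closed_map u <-> continuous u.

Definition contains_banach_spaces C : Prop :=
  forall B : completeNormedModType K, C B.

Definition closed_under_quotients C : Prop :=
  forall E, C E -> forall A : submodClosed E, closed [set` A] -> C (tvs_quot A).

Definition closed_under_closed_graphs C : Prop :=
  forall E F, C E -> C F -> forall u : {linear E -> F},
    closed_map u -> C (graph_tvs u).

Definition closed_under_continuous_images C : Prop :=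
  forall E F, C E -> kolmogorov_space F -> forall u : {linear E -> F},
    injective u -> continuous u -> nearly_open u -> C (image_tvs u).

Definition admissible_class C : Prop :=
  (forall E, C E -> kolmogorov_space E) /\
  [/\ contains_banach_spaces C,
      closed_under_quotients C,
      closed_under_closed_graphs C,
      closed_under_continuous_images C &
      [\/ open_mapping_property C,
          continuous_inverse_property C |
          closed_graph_property C]].

End MapsAndClasses.

Section Barreled.
Context (K : numFieldType) (E : tvsType K).

Definition circled (B : set E) : Prop :=
  forall k : K, `|k| <= 1 -> forall x, B x -> B (k *: x).

Definition absorbing (B : set E) : Prop :=
  forall x, exists2 r : K, 0 < r &
    forall k : K, r <= `|k| -> exists2 b, B b & x = k *: b.

Definition barrel (B : set E) : Prop :=
  [/\ closed B, convex_set B, circled B & absorbing B].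

Definition barreled : Prop := forall B : set E, barrel B -> nbhs 0 B.

End Barreled.

Section Dual.
Context (K : numFieldType) (E : tvsType K).

Definition dual_pred : {pred E -> K^o} :=
  [pred f | `[< linear f /\ continuous f >]].

Fact dual_submod_closed : submod_closed dual_pred.
Proof.
split.
  apply: asboolT; split; last by move=> x; exact: cvg_cst.
  by move=> k x y; rewrite /= scaler0 addr0.
move=> k f g fA gA; have [fl fc] := asboolW fA; have [gl gc] := asboolW gA.
apply: asboolT; split.
  move=> a x y; rewrite !fctE /= fl gl !scalerDr !scalerA [k * a]mulrC.
  by rewrite addrACA.
by move=> x; apply: cvgD; [apply: cvgZr; exact: fc|exact: gc].
Qed.

HB.instance Definition _ := GRing.isSubmodClosed.Build K (E -> K^o) dual_pred
  dual_submod_closed.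

Definition dual : Type := {f : E -> K^o | f \in dual_pred}.

HB.instance Definition _ := SubChoice.on dual.
HB.instance Definition _ := [SubChoice_isSubLmodule of dual by <:].

(* The weak-* topology, induced by the topology of pointwise convergence. *)
HB.instance Definition _ := Topological.copy dual
  (initial_topology (\val : dual -> {ptws E -> K^o})).

Definition ptak : Prop :=
  forall Q : submodClosed dual,
    (forall A : set dual, equicontinuous A (\val : dual -> E -> K^o) ->
       closed ([set` Q] `&` A : set (subspace A))) ->
    closed [set` Q].

End Dual.

Definition barreled_ptak (K : numFieldType) : tvs_class K :=
  fun E => [/\ kolmogorov_space E, barreled E & ptak E].

(* Main.v *)
(* Any of (O), (C), (G) implies the other two for a class closed under
   quotients and closed graphs, by factoring a surjection through its kernel
   and by projecting a closed graph onto the domain.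

   Let E be in an admissible class. For a barrel B, the evaluation of E on the
   polar of B, with values in the Banach space of bounded functions on E', has a
   closed graph, hence is continuous; since B is its own bipolar, B is
   a neighborhood of 0. To see that E is a Ptak space, let Q be an almost closed
   subspace of E' with annihilator A, and let F be E/A with the topology of
   uniform convergence on the sets of elements of Q bounded by 1 on a neighborhood
   of 0 in E.
   By the bipolar theorem the dual of F is Q, and the identity E/A -> F is
   continuous and nearly open. So F is in the class and this identity is an
   isomorphism by (C), which forces Q to contain every functional vanishing on A.
   The same criterion shows that Banach spaces are Ptak spaces.

   Conversely, for u : E -> F the functionals on E (respectively F) that are
   compatible with u form an almost closed separating subspace of the dual, which
   is the whole dual of a Ptak space: this gives the open mapping theorem for
   nearly open maps and the closed graph theorem, hence the closure properties
   and (G) for barreled Ptak spaces. *)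
Require Import Defs.
From HB Require Import structures.
From mathcomp Require Import all_boot all_order all_algebra.
From mathcomp Require Import complex.
From mathcomp Require Import all_classical all_reals all_analysis.
From mathcomp Require Import ring lra.

Set Implicit Arguments.
Unset Strict Implicit.
Unset Printing Implicit Defensive.

Import Order.TTheory GRing.Theory Num.Theory.
Import numFieldTopology.Exports numFieldNormedType.Exports.

Local Open Scope classical_set_scope.
Local Open Scope ring_scope.

(** * Hahn-Banach theorem over the real and complex numbers *)

Section RealHahnBanach.
Context (R : realType) (V : lmodType R).
Implicit Types (p q : V -> R).

(** Homogeneity is an inequality for positive factors only, the form that passes to infima; equality
    follows by applying it to the inverse factor. *)
Definition sublinear q : Prop :=
  (forall x y, q (x + y) <= q x + q y) /\
  (forall (t : R) x, 0 < t -> q (t *: x) <= t * q x).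

Lemma sublinearZ q t x : sublinear q -> 0 < t -> q (t *: x) = t * q x.
Proof.
move=> [_ qZ] t0; apply/eqP; rewrite eq_le qZ//=.
rewrite -ler_pdivlMl//; apply: le_trans (qZ t^-1 _ _); last by rewrite invr_gt0.
by rewrite scalerA mulVf ?scale1r// gt_eqF.
Qed.

Lemma sublinear0 q : sublinear q -> q 0 = 0.
Proof.
move=> sq; have := sublinearZ 0 sq (ltr0n R 2).
by rewrite scaler0 => ?; lra.
Qed.

Lemma sublinearN_ge q x : sublinear q -> - q (- x) <= q x.
Proof.
by move=> sq; have := sq.1 x (- x); rewrite subrr sublinear0//; lra.
Qed.

(** The pointwise infimum of a family bounded below by [m]. The last two hypotheses are a
    directedness condition, met by chains and by the family of shifts below. *)
Lemma sublinear_inf (A : set (V -> R)) q0 (m : V -> R) : A q0 ->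
  (forall q x, A q -> m x <= q x) ->
  (forall q, A q -> forall (t : R) x, 0 < t -> exists2 r, A r & r (t *: x) <= t * q x) ->
  (forall q r, A q -> A r -> forall x y, exists2 s, A s & s (x + y) <= q x + r y) ->
  exists2 r, sublinear r & (forall q x, A q -> r x <= q x) /\ (forall x, m x <= r x).
Proof.
move=> Aq0 Am AZ AD; pose r x := inf [set q x | q in A].
have rle q x : A q -> r x <= q x.
  move=> Aq; apply: ge_inf; last by exists q.
  by exists (m x) => _ [s As <-]; exact: Am.
have rge c x : (forall q, A q -> c <= q x) -> c <= r x.
  move=> cq; apply: lb_le_inf; first by exists (q0 x); exists q0.
  by move=> _ [s As <-]; exact: cq.
exists r; last by split => // x; apply: rge => q; exact: Am.
split=> [x y|t x t0].
  rewrite -lerBlDr; apply: (rge) => q Aq; rewrite lerBlDr -lerBlDl.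
  apply: (rge) => s As; rewrite lerBlDl.
  by have [u Au] := AD _ _ Aq As x y; apply: le_trans; exact: rle.
rewrite -ler_pdivrMl//; apply: rge => q Aq; rewrite ler_pdivrMl//.
by have [u Au] := AZ _ Aq t x t0; apply: le_trans; exact: rle.
Qed.

(** Zorn's lemma for the reversed pointwise order. A nonempty chain below [p] has an infimum,
    because all its members lie above [- p (- x)]. *)
Lemma sublinear_minimal p : sublinear p -> exists2 q, sublinear q &
  (forall x, q x <= p x) /\
  forall r, sublinear r -> (forall x, r x <= q x) -> forall x, q x <= r x.
Proof.
move=> sp; pose T := {q | sublinear q /\ forall x, q x <= p x}.
pose le (q r : T) := `[< forall x, sval r x <= sval q x >].
have [| |A|[q [sq qp]] qmin] := @ZL_preorder T (exist _ p (conj sp (fun=> lexx _))) le.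
- by move=> q; apply/asboolP => x.
- move=> r s t /asboolP rs /asboolP st; apply/asboolP => x.
  exact: le_trans (st x) (rs x).
- move=> totA; have [[q0 Aq0]|A0] := pselect (exists q : T, A q); last first.
    by exists (exist _ p (conj sp (fun=> lexx _))) => s As; exfalso; apply: A0; exists s.
  have [||||r sr [rA _]] := @sublinear_inf [set sval q | q in A] (sval q0) (fun x => - p (- x)).
  + by exists q0.
  + move=> _ x [[q [sq qp]] Aq <-] /=; apply: le_trans (sublinearN_ge x sq).
    by rewrite lerN2.
  + move=> _ [q Aq <-] t x t0; exists (sval q); first by exists q.
    by case: (svalP q) => sq _; rewrite sublinearZ.
  + move=> _ _ [q Aq <-] [s As <-] x y.
    have [/asboolP qs|/asboolP sq] := totA _ _ Aq As.
      exists (sval s); first by exists s.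
      by apply: le_trans ((svalP s).1.1 x y) _; rewrite lerD2r.
    exists (sval q); first by exists q.
    by apply: le_trans ((svalP q).1.1 x y) _; rewrite lerD2l.
  have rp x : r x <= p x.
    by apply: le_trans ((svalP q0).2 x); apply: rA; exists q0.
  exists (exist _ r (conj sr rp)) => s As; apply/asboolP => x /=.
  by apply: rA; exists s.
exists q => //; split=> // r sr rq.
have rp x : r x <= p x by exact: le_trans (rq x) (qp x).
by have /(_ (asboolT rq))/asboolP := qmin (exist _ r (conj sr rp)).
Qed.

(** Taking [t = 0] gives [r <= q], and [t = 1] at [- y] gives [r (- y) <= - q y]; both are used
    below. *)
Lemma sublinear_shift q y : sublinear q -> exists2 r, sublinear r &
  (forall x t, 0 <= t -> r x <= q (x + t *: y) - t * q y).
Proof.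
move=> sq.
have [||||r sr [rA _]] := @sublinear_inf
  [set (fun x => q (x + t *: y) - t * q y) | t in [set t | 0 <= t]]
  (fun x => q (x + 0 *: y) - 0 * q y) (fun x => - q (- x)).
- by exists 0 => //=; exact: lexx.
- move=> _ x [t /= t0 <-].
  have {t0} [->|t0] : t = 0 \/ 0 < t by move: t0; rewrite le_eqVlt => /orP[/eqP|]; [left|right].
    by rewrite scale0r addr0 mul0r subr0; exact: sublinearN_ge.
  rewrite -sublinearZ//; have := sq.1 (x + t *: y) (- x).
  by rewrite addrC addKr; lra.
- move=> _ [t /= t0 <-] s x s0; exists (fun x => q (x + (s * t) *: y) - (s * t) * q y).
    by exists (s * t) => //; rewrite mulr_ge0// ltW.
  by rewrite -scalerA -scalerDr sublinearZ// mulrBr mulrA.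
- move=> _ _ [s /= s0 <-] [t /= t0 <-] x z.
  exists (fun x => q (x + (s + t) *: y) - (s + t) * q y).
    by exists (s + t) => //; rewrite addr_ge0.
  have := sq.1 (x + s *: y) (z + t *: y).
  by rewrite addrACA -scalerDl; lra.
exists r => // x t t0.
by have /(_ x) := rA (fun x => q (x + t *: y) - t * q y); apply; exists t.
Qed.

(* A minimal sublinear functional [q] is additive: it lies below the
   sublinear functional [inf_t q (x + t y) - t q y], whose value at [x] is at
   most [q (x + y) - q y]. *)
Lemma sublinear_minimal_linear q : sublinear q ->
  (forall r, sublinear r -> (forall x, r x <= q x) -> forall x, q x <= r x) ->
  linear (q : V -> R^o).
Proof.
move=> sq qmin.
have qD x y : q (x + y) = q x + q y.
  apply/eqP; rewrite eq_le sq.1/=.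
  have [r sr rq] := sublinear_shift y sq.
  have : q x <= r x.
    apply: qmin => // z; apply: le_trans (rq z 0 (lexx _)) _.
    by rewrite scale0r addr0 mul0r subr0.
  by have := rq x 1 ler01; rewrite scale1r mul1r; lra.
have q0 := sublinear0 sq.
have qN x : q (- x) = - q x.
  by have := qD x (- x); rewrite subrr q0; lra.
move=> a x y; rewrite qD; congr (_ + _); rewrite -[RHS]/(a * q x).
have [a0|a0|->] := ltgtP a 0; last by rewrite scale0r mul0r q0.
  by rewrite -[LHS]opprK -qN -scaleNr sublinearZ ?oppr_gt0// mulNr opprK.
exact: sublinearZ.
Qed.

(** A minimal functional is taken below the shift of [p] along [x0], not merely below [p]. The shift
    is at most [- p x0] at [- x0], so linearity forces the value at [x0] up to [p x0]. *)
Lemma real_hahn_banach p x0 : sublinear p ->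
  exists2 f : V -> R^o, linear f & (forall x, f x <= p x) /\ p x0 <= f x0.
Proof.
move=> sp; have [r sr rp] := sublinear_shift x0 sp.
have [q sq [qr qmin]] := sublinear_minimal sr.
have lq := sublinear_minimal_linear sq qmin.
exists q => //; split.
  move=> x; apply: le_trans (qr x) _; apply: le_trans (rp x 0 (lexx _)) _.
  by rewrite scale0r addr0 mul0r subr0.
have := rp (- x0) 1 ler01; rewrite scale1r mul1r addNr sublinear0//.
have := qr (- x0); have := sublinearN_ge (- x0) sq; rewrite opprK.
by have := lq 1 x0 (- x0); rewrite scale1r subrr (sublinear0 sq) /GRing.scale/= mul1r; lra.
Qed.

(** Hahn-Banach applied to the Minkowski gauge [p] of [W], which is at most 1 on [W] and at least 1
    at a point outside [W]. *)
Lemma real_hahn_banach_convex (W : set V) x0 :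
  (forall a b x y, 0 <= a -> 0 <= b -> a + b = 1 -> W x -> W y -> W (a *: x + b *: y)) ->
  W 0 -> (forall x, exists2 t, 0 < t & W (t *: x)) -> ~ W x0 ->
  exists2 f : V -> R^o, linear f & (forall x, W x -> f x <= 1) /\ 1 <= f x0.
Proof.
move=> Wc W0 Wa Wx0.
have Wle x t s : 0 < s -> s <= t -> W (t *: x) -> W (s *: x).
  move=> s0 st Wx; have t0 : 0 < t by exact: lt_le_trans st.
  have -> : s *: x = (s / t) *: (t *: x) + (1 - s / t) *: 0.
    by rewrite scaler0 addr0 scalerA divfK ?gt_eqF.
  apply: Wc => //; last by rewrite addrC subrK.
    by rewrite divr_ge0// ltW.
  by rewrite subr_ge0 ler_pdivrMr// mul1r.
pose S x := [set t | 0 < t /\ W (t^-1 *: x)]; pose p x := inf (S x).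
have S0 x : S x !=set0.
  have [t t0 Wtx] := Wa x; exists t^-1; split; first by rewrite invr_gt0.
  by rewrite invrK.
have p_ge x c : (forall t, 0 < t -> W (t^-1 *: x) -> c <= t) -> c <= p x.
  by move=> cS; apply: lb_le_inf => // t [t0 Wt]; exact: cS.
have p_le x t : 0 < t -> W (t^-1 *: x) -> p x <= t.
  by move=> t0 Wx; apply: ge_inf => //; exists 0 => s [/ltW].
have sp : sublinear p.
  split=> [x y|t x t0].
    rewrite -lerBlDr; apply: (p_ge) => a a0 Wx; rewrite lerBlDr -lerBlDl.
    apply: (p_ge) => b b0 Wy; rewrite lerBlDl.
    apply: (p_le); first exact: addr_gt0.
    have ab0 : a + b != 0 by rewrite gt_eqF// addr_gt0.
    have -> : (a + b)^-1 *: (x + y) =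
        (a / (a + b)) *: (a^-1 *: x) + (b / (a + b)) *: (b^-1 *: y).
      rewrite !scalerA scalerDr; congr (_ *: _ + _ *: _).
        by rewrite mulrAC divff ?mul1r// gt_eqF.
      by rewrite mulrAC divff ?mul1r// gt_eqF.
    apply: Wc => //; rewrite ?divr_ge0 ?addr_ge0// ?ltW//.
    by rewrite -mulrDl divff.
  rewrite -ler_pdivrMl//; apply: (p_ge) => a a0 Wx; rewrite ler_pdivrMl//.
  apply: (p_le); first exact: mulr_gt0.
  by rewrite invfM scalerA mulrAC mulVf ?gt_eqF// mul1r.
have [f lf [fp pf]] := real_hahn_banach x0 sp.
exists f => //; split.
  move=> x Wx; apply: le_trans (fp x) _; apply: (p_le) => //.
  by rewrite invr1 scale1r.
apply: le_trans pf; apply: (p_ge) => t t0 Wt; rewrite leNgt; apply/negP => t1.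
apply: Wx0; rewrite -[x0]scale1r; apply: Wle Wt => //.
by rewrite -invr1 lef_pV2 ?posrE// ltW.
Qed.

End RealHahnBanach.

(** * Absolutely convex sets *)

Section Disk.
Context (K : numFieldType) (V : lmodType K).
Implicit Types (D U : set V).

Definition disk D : Prop :=
  D 0 /\ forall (a b : K) x y, `|a| + `|b| <= 1 -> D x -> D y -> D (a *: x + b *: y).

Lemma diskZ D (a b : K) x : disk D -> `|a| <= `|b| -> D (b *: x) -> D (a *: x).
Proof.
move=> [D0 dD] ab Dbx; have [b0|b0] := eqVneq b 0.
  by move: ab; rewrite b0 normr0 normr_le0 => /eqP ->; rewrite scale0r.
have := dD (a / b) 0 _ 0 _ Dbx D0; rewrite scaler0 addr0 scalerA divfK//; apply.
by rewrite normr0 addr0 normf_div ler_pdivrMr ?normr_gt0// mul1r.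
Qed.

Lemma diskZ1 D (a : K) x : disk D -> `|a| <= 1 -> D x -> D (a *: x).
Proof. by move=> dD a1 Dx; apply: (@diskZ _ a 1); rewrite ?normr1 ?scale1r. Qed.

Lemma diskN D x : disk D -> D x -> D (- x).
Proof. by move=> dD Dx; rewrite -scaleN1r; apply: diskZ1; rewrite // normrN1. Qed.

Lemma disk_half D x y : disk D -> D x -> D y -> D (2^-1 *: x + 2^-1 *: y).
Proof.
move=> dD Dx Dy; apply: dD.2 => //; rewrite ger0_norm ?invr_ge0//.
by rewrite -[X in X + X]div1r -splitr.
Qed.

Lemma disk_convex D : disk D -> convex_set (D : set (convex_lmodType V)).
Proof.
move=> dD x y l /[!inE] Dx Dy; apply: dD.2 => //.
by rewrite !ger0_norm /unstable.onem ?subr_ge0// addrC subrK.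
Qed.

(** Moving the phases of [a] and [b] into the vectors turns [a *: x + b *: y] into a convex
    combination with weights [|a|] and [1 - |a|]. The auxiliary fact [unit] does this, including for
    a weight equal to 0. *)
Lemma convex_circled_disk D : D 0 -> convex_set (D : set (convex_lmodType V)) ->
  (forall k : K, `|k| <= 1 -> forall x, D x -> D (k *: x)) -> disk D.
Proof.
move=> D0 cD bD; split=> // a b x y ab Dx Dy.
have a1 : `|a| <= 1 by apply: le_trans ab; rewrite lerDl.
pose l := Itv01 (normr_ge0 a) a1.
have unit (c : K) z (t : K) : 0 <= t -> `|c| <= t -> D z -> exists2 w, D w & c *: z = t *: w.
  move=> t0 ct Dz; have [t00|tn0] := eqVneq t 0.
    exists 0 => //; move: ct; rewrite t00 normr_le0 => /eqP ->.
    by rewrite !scale0r.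
  exists ((c / t) *: z); last by rewrite scalerA mulrCA divff// mulr1.
  apply: bD => //; rewrite normf_div (ger0_norm t0) ler_pdivrMr ?mul1r//.
  by rewrite lt_neqAle eq_sym tn0.
have [x' Dx' ->] := unit a x `|a| (normr_ge0 _) (lexx _) Dx.
have [||y' Dy' ->] := unit b y (1 - `|a|) _ _ Dy; first by rewrite subr_ge0.
  by rewrite lerBrDl.
by have := cD x' y' l; rewrite !inE; apply.
Qed.

Lemma diskD D U : disk D -> disk U -> disk [set z | exists x y, [/\ D x, U y & z = x + y]].
Proof.
move=> dD dU; split; first by exists 0, 0; rewrite addr0; split; [exact: dD.1|exact: dU.1|].
move=> a b _ _ ab [x1 [y1 [Dx1 Uy1 ->]]] [x2 [y2 [Dx2 Uy2 ->]]].
exists (a *: x1 + b *: x2), (a *: y1 + b *: y2); split; [exact: dD.2|exact: dU.2|].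
by rewrite !scalerDr addrACA.
Qed.

End Disk.

(** * Separation over the complex numbers, by restriction of scalars *)

Section Realify.
Local Open Scope complex_scope.
Context (R : realType) (V : lmodType R[i]).

Definition realify : Type := V.

HB.instance Definition _ := GRing.Zmodule.on realify.

Definition realify_scale (a : R) (x : realify) : realify := a%:C *: (x : V).

Fact realify_scalerA a b v :
  realify_scale a (realify_scale b v) = realify_scale (a * b) v.
Proof. by rewrite /realify_scale scalerA -rmorphM. Qed.

Fact realify_scale1r : left_id 1 realify_scale.
Proof. by move=> v; rewrite /realify_scale scale1r. Qed.

Fact realify_scalerDr : right_distributive realify_scale +%R.
Proof. by move=> a u v; rewrite /realify_scale scalerDr. Qed.

Fact realify_scalerDl v : {morph realify_scale^~ v : a b / a + b}.
Proof. by move=> a b; rewrite /realify_scale rmorphD scalerDl. Qed.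

HB.instance Definition _ := GRing.Zmodule_isLmodule.Build R realify
  realify_scalerA realify_scale1r realify_scalerDr realify_scalerDl.

Lemma realify_scaleE (a : R) (x : realify) : a *: x = a%:C *: (x : V) :> V.
Proof. by []. Qed.

(** A real functional [f] is the real part of the complex linear functional
    [g x = f x - i f (i x)]. *)
Lemma complex_hahn_banach_disk (W : set V) x0 : disk W ->
  (forall x, exists2 k : R[i], k != 0 & W (k *: x)) -> ~ W x0 ->
  exists2 f : V -> R[i]^o, linear f & (forall x, W x -> `|f x| <= 1) /\ 1 <= `|f x0|.
Proof.
move=> dW aW Wx0.
have [||||f lf [fW fx0]] := @real_hahn_banach_convex R realify W x0 => //.
- move=> a b x y a0 b0 ab Wx Wy; rewrite /= !realify_scaleE; apply: dW.2 => //.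
  by rewrite !ger0_norm ?ler0c// -rmorphD/= ab.
- exact: dW.1.
- move=> x; have [k k0 Wk] := aW x; exists (complex.Re `|k|).
    by rewrite -ltcR RRe_real ?normr_gt0// normr_real.
  by rewrite realify_scaleE RRe_real ?normr_real//; apply: diskZ Wk; rewrite ?normr_id.
have fD (x y : V) : f (x + y) = f x + f y.
  by have := lf 1 x y; rewrite realify_scaleE !scale1r.
have fZ (a : R) (x : V) : f (a%:C *: x) = a * f x.
  have f0 : f 0 = 0 by have := fD 0 0; rewrite addr0; lra.
  by have := lf a x 0; rewrite realify_scaleE !addr0 f0 addr0.
pose i := ('i : R[i]).
pose g (x : V) : R[i]^o := f x +i* (- f (i *: x)).
have gD x y : g (x + y) = g x + g y.
  by rewrite /g scalerDr !fD opprD.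
have fC (a b : R) (x : V) : f ((a +i* b) *: x) = a * f x + b * f (i *: x).
  have -> : a +i* b = a%:C + b%:C * i by rewrite /i; simpc.
  by rewrite scalerDl -scalerA fD !fZ.
have gZ (k : R[i]) x : g (k *: x) = k * g x.
  case: k => a b; rewrite /g scalerA.
  have -> : i * (a +i* b) = (- b) +i* a by rewrite /i; simpc.
  by rewrite (fC (- b) a) (fC a b); simpc; apply/eqP; rewrite eq_complex/=; apply/andP; split; apply/eqP; ring.
exists g; first by move=> k x y; rewrite gD gZ.
split=> [x Wx|].
  have [->|g0] := eqVneq (g x) 0; first by rewrite normr0.
  (* Rotating [x] by a scalar of modulus 1 stays in the disk and makes [g] real and nonnegative,
     hence equal to its real part [f] there. *)
  pose c := `|g x| / g x.
  have c1 : `|c| = 1 by rewrite normf_div normr_id divff// normr_eq0.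
  have gc : g (c *: x) = `|g x| by rewrite gZ divfK.
  rewrite -gc; have /= <- : (f (c *: x))%:C = g (c *: x).
    by rewrite gc -(RRe_real (normr_real (g x))) -gc.
  by rewrite lecR; apply: fW; apply: diskZ1; rewrite ?c1.
apply: le_trans (normc_ge_Re (g x0)); rewrite /= lecR.
exact: le_trans fx0 (ler_norm _).
Qed.

End Realify.

Lemma real_hahn_banach_disk (R : realType) (V : lmodType R) (W : set V) x0 : disk W ->
  (forall x, exists2 k : R, k != 0 & W (k *: x)) -> ~ W x0 ->
  exists2 f : V -> R^o, linear f & (forall x, W x -> `|f x| <= 1) /\ 1 <= `|f x0|.
Proof.
move=> dW aW Wx0.
have [||||f lf [fW fx0]] := @real_hahn_banach_convex R V W x0 => //.
- by move=> a b x y a0 b0 ab Wx Wy; apply: dW.2; rewrite // !ger0_norm ?ab.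
- exact: dW.1.
- move=> x; have [k k0 Wk] := aW x; exists `|k|; first by rewrite normr_gt0.
  by apply: diskZ Wk; rewrite ?normr_id.
have f0 : f 0 = 0 by have := lf 1 0 0; rewrite scaler0 scale1r addr0; lra.
exists f => //; split=> [x Wx|]; last exact: le_trans fx0 (ler_norm _).
rewrite ler_norml fW// andbT.
have := fW _ (diskN dW Wx).
by have := lf (-1) x 0; rewrite f0 !addr0 !scaleN1r; lra.
Qed.

(** * Completeness, suprema and strict separation over both fields *)

Lemma real_cauchy_cvg (R : realType) (F : set_system R) : ProperFilter F ->
  (forall e : R, 0 < e -> exists x, F [set y | `|x - y| < e]) ->
  exists l, forall e : R, 0 < e -> F [set y | `|l - y| < e].
Proof.
move=> FF cF; have /cvg_ex[l Fl] : cvg F.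
  by apply: R_complete; apply: cauchy_exP => e e0; have [x] := cF e e0; exists x.
exists l => e e0; apply: (Fl [set y | `|l - y| < e]).
by apply/nbhs_ballP; exists e.
Qed.

Lemma complex_cauchy_cvg (R : realType) (F : set_system R[i]) : ProperFilter F ->
  (forall e : R[i], 0 < e -> exists x, F [set y | `|x - y| < e]) ->
  exists l, forall e : R[i], 0 < e -> F [set y | `|l - y| < e].
Proof.
move=> FF cF; have lePart (p : R[i] -> R) :
    (forall z, (`|p z|%:C <= `|z|)%C) -> (forall x y, p (x - y) = p x - p y) ->
    exists l : R, forall e : R, 0 < e -> F [set y | `|l - p y| < e].
  move=> ple pB; have [e e0|l Fl] := @real_cauchy_cvg R (p @ F) _.
    have [|x Fx] := cF e%:C%C; first by rewrite ltcR.
    exists (p x); change (F [set y | `|p x - p y| < e]); apply: filterS Fx => y /= xy; rewrite -ltcR -pB.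
    exact: le_lt_trans (ple _) xy.
  by exists l.
have [a Fa] := lePart _ (@normc_ge_Re R) (fun x y => raddfB (@complex.Re R) x y).
have normi : `|'i%C| = 1 :> R[i].
  by rewrite normc_def/= expr0n/= add0r expr1n sqrtr1.
have ge_Im (z : R[i]) : (`|complex.Im z|%:C <= `|z|)%C.
  by have := normc_ge_Re (z * 'i%C); rewrite ReiNIm normrN normrM normi mulr1.
have [b Fb] := lePart _ ge_Im (fun x y => raddfB (@complex.Im R) x y).
exists (a +i* b)%C => e e0.
have [r er] : exists r : R, e = (r%:C)%C.
  by exists (complex.Re e); rewrite RRe_real// gtr0_real.
have r0 : 0 < r / 2 by rewrite divr_gt0// -ltcR -er.
apply: filterS2 (Fa _ r0) (Fb _ r0) => -[c d] /= ac bd.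
rewrite er [X in `|X|]complexE; apply: le_lt_trans (ler_normD _ _) _.
rewrite normrM normi mul1r !normc_def/= expr0n/= !addr0 !sqrtr_sqr -rmorphD ltcR.
by rewrite [r]splitr ltrD.
Qed.

Section Scalars.
Context (R : realType) (K : numFieldType) (KRC : real_or_complex R K).

(** The two fields are told apart only here and in the next three lemmas; everything later goes
    through these four. *)
Lemma hahn_banach_disk (V : lmodType K) (W : set V) x0 : disk W ->
  (forall x, exists2 k : K, k != 0 & W (k *: x)) -> ~ W x0 ->
  exists2 f : V -> K^o, linear f & (forall x, W x -> `|f x| <= 1) /\ 1 <= `|f x0|.
Proof.
by case: KRC => E; subst K; [exact: real_hahn_banach_disk|exact: complex_hahn_banach_disk].
Qed.

Lemma scalar_cauchy_cvg (F : set_system K) : ProperFilter F ->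
  (forall e : K, 0 < e -> exists x, F [set y | `|x - y| < e]) ->
  exists l, forall e : K, 0 < e -> F [set y | `|l - y| < e].
Proof.
by case: KRC => E; subst K; [exact: real_cauchy_cvg|exact: complex_cauchy_cvg].
Qed.

(** The order of the complex numbers is partial, but the bounds 0 and [M] put all of [A] on the real
    axis, where the supremum is taken. *)
Lemma scalar_sup (A : set K) M : A !=set0 -> (forall a, A a -> 0 <= a <= M) ->
  exists s, (forall a, A a -> a <= s) /\ forall t, (forall a, A a -> a <= t) -> s <= t.
Proof.
case: KRC => E; subst K => A0 AM.
  exists (sup A); split.
    by move=> a Aa; apply: ub_le_sup => //; exists M => b /AM/andP[].
  by move=> t At; apply: ge_sup.
have nnE (z : R[i]) : 0 <= z -> exists2 r : R, 0 <= r & z = (r%:C)%C.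
  move=> z0; have zE := RRe_real (ger0_real z0).
  by exists (complex.Re z); rewrite ?zE// -ler0c zE.
pose B := [set r : R | A (r%:C)%C].
have [a Aa] := A0; have /andP[a0 aM] := AM _ Aa.
have [m _ Mm] := nnE M (le_trans a0 aM).
have [r _ ar] := nnE a a0.
have B0 : B !=set0 by exists r; rewrite /B/= -ar.
exists ((sup B)%:C)%C; split=> [b Ab|t At].
  have /andP[b0 bM] := AM _ Ab; have [s _ bs] := nnE b b0.
  rewrite bs lecR; apply: ub_le_sup; last by rewrite /B/= -bs.
  by exists m => u /AM/andP[_]; rewrite Mm lecR.
have [u _ tu] := nnE t (le_trans a0 (At _ Aa)).
by rewrite tu lecR; apply: ge_sup => // s /At; rewrite tu lecR.
Qed.

Lemma scalar_exp2V_small (e : K) : 0 < e -> exists n, 2^-1 ^+ n < e.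
Proof.
have small (r : R) : 0 < r -> exists n, 2^-1 ^+ n < r.
  move=> r0; have h1 : `|2^-1 : R| < 1 by rewrite ger0_norm ?invf_lt1// ?ltr1n// invr_ge0.
  have /cvgr0Pnorm_lt /(_ r r0)[n _ /(_ n (leqnn n))] := cvg_expr h1.
  by rewrite ger0_norm ?exprn_ge0 ?invr_ge0//; exists n.
case: KRC => E; subst K => e0; first exact: small.
have eE := RRe_real (gtr0_real e0).
have [|n en] := small (complex.Re e); first by rewrite -ltcR eE.
exists n; rewrite -eE; have -> : (2^-1 : R[i]) = ((2^-1 : R)%:C)%C.
  by rewrite fmorphV rmorph_nat.
by rewrite -rmorphXn ltcR.
Qed.

(** Separating [(1 - h) *: x0] from [D] plus half of [U], for a suitable [h > 0], makes the
    inequality at [x0] strict. The bound 2 on [U] comes from the bound 1 on its half; it yields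
    continuity when [U] is a neighborhood of 0. *)
Lemma hahn_banach_strict (V : lmodType K) (D U : set V) x0 : disk D -> disk U ->
  (forall x, exists2 k : K, k != 0 & U (k *: x)) ->
  (forall x y, D x -> U y -> x0 <> x + y) ->
  exists2 f : V -> K^o, linear f &
    [/\ forall x, D x -> `|f x| <= 1, forall x, U x -> `|f x| <= 2 & 1 < `|f x0|].
Proof.
move=> dD dU aU x0DU; pose U' := [set x | U (2 *: x)].
have dU' : disk U'.
  split; first by rewrite /U'/= scaler0; exact: dU.1.
  move=> a b x y ab Ux Uy; rewrite /U'/= scalerDr !scalerA ![2 * _]mulrC -!scalerA.
  exact: dU.2.
have n2 : (2 : K) != 0 by rewrite pnatr_eq0.
have U'h y : U y -> U' (2^-1 *: y) by rewrite /U'/= scalerA divff// scale1r.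
(* This [h] satisfies [1 - h = 1 / (1 + t)] and [2 * h <= |k|], so [h *: x0] lies in half of [U] and
   the final value is at least [1 + t]. *)
have [k k0 Uk] := aU x0; pose t := `|k| / 2; pose h := t / (1 + t).
have t0 : 0 < t by rewrite divr_gt0// normr_gt0.
have t1 : 0 < 1 + t by rewrite addr_gt0.
have h0 : 0 < h by rewrite divr_gt0.
have hE : 1 - h = (1 + t)^-1.
  by rewrite /h -[X in X - _](divff (lt0r_neq0 t1)) -mulrBl addrK div1r.
have Uh : U' (h *: x0).
  rewrite /U'/= scalerA; apply: diskZ Uk => //.
  rewrite (gtr0_norm (mulr_gt0 _ h0))// -ler_pdivlMl// [2^-1 * _]mulrC -/t /h.
  by rewrite ler_pdivrMr// ler_pMr// lerDl ltW.
have [||f lf [fW fx0]] := @hahn_banach_disk V _ ((1 - h) *: x0) (diskD dD dU').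
- move=> x; have [c c0 Uc] := aU x; exists (2^-1 * c); first by rewrite mulf_neq0// invr_eq0.
  exists 0, ((2^-1 * c) *: x); rewrite add0r; split => //; first exact: dD.1.
  by rewrite -scalerA; exact: U'h.
- move=> [x [y [Dx Uy]]] xy; apply: (x0DU x (y + h *: x0)) => //; last first.
    by rewrite addrA -xy -scalerDl subrK scale1r.
  have Uy2 : U (2 *: y) := Uy; have Uh2 : U (2 *: (h *: x0)) := Uh.
  by have := disk_half dU Uy2 Uh2; rewrite !scalerA mulVf// scale1r mulKf.
have fZ a x : f (a *: x) = a * f x.
  have f0 : f 0 = 0.
    by have := lf 1 0 0; rewrite scaler0 addr0 scale1r => /eqP; rewrite -subr_eq0 opprD addNKr oppr_eq0 => /eqP.
  by have := lf a x 0; rewrite !addr0 f0 addr0.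
exists f => //; split.
- by move=> x Dx; apply: fW; exists x, 0; rewrite addr0; split => //; exact: dU'.1.
- move=> x Ux; have : `|f (2^-1 *: x)| <= 1.
    by apply: fW; exists 0, (2^-1 *: x); rewrite add0r; split => //; [exact: dD.1|exact: U'h].
  by rewrite fZ normrM ger0_norm ?invr_ge0// ler_pdivrMl// mulr1.
- move: fx0; rewrite fZ hE normrM gtr0_norm ?invr_gt0// ler_pdivlMl// mulr1.
  by apply: lt_le_trans; rewrite ltrDl.
Qed.

End Scalars.

(** * Locally convex spaces *)

Lemma conv_lmodE (K : numFieldType) (V : lmodType K) (x y : V) (l : {i01 K}) :
  conv l (x : convex_lmodType V) (y : convex_lmodType V) = l%:num *: x + (1 - l%:num) *: y.
Proof. by []. Qed.

Section TvsTheory.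
Context (K : numFieldType) (E : tvsType K).
Implicit Types (U V D : set E) (x y : E).

Lemma nbhs_shift x U : nbhs x U <-> nbhs 0 [set y | U (x + y)].
Proof.
split=> [/(nbhsB (- x))|/(nbhsT x)].
  by rewrite addNr; apply: filterS => _ [y Uy <-]; rewrite /= addNKr.
by apply: filterS => _ [y Uy <-].
Qed.

Lemma nbhs0_add U : nbhs 0 U ->
  exists2 V, nbhs 0 V & forall x y, V x -> V y -> U (x + y).
Proof.
have := @add_continuous E (0, 0) U; rewrite /= addr0 => /[apply] -[[V W]] /= [V0 W0] VW.
by exists (V `&` W); [exact: filterI|move=> x y [Vx _] [_ Wy]; exact: (VW (x, y))].
Qed.

Lemma nbhs0_scale (k : K) U : k != 0 -> nbhs 0 U -> nbhs 0 [set x | U (k *: x)].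
Proof.
move=> k0 /(nbhs0Z (invr_neq0 k0)); apply: filterS => _ [y Uy <-] /=.
by rewrite scalerA divff// scale1r.
Qed.

Lemma nbhs0_circled U : nbhs 0 U -> exists2 d : K, 0 < d &
  exists2 V, nbhs 0 V & forall k x, `|k| < d -> V x -> U (k *: x).
Proof.
have := @scale_continuous K E (0, 0) U; rewrite /= scaler0 => /[apply] -[[V W]] /= [V0 W0] VW.
have /nbhs_ballP[d d0 dV] := V0.
exists d => //; exists W => // k x kd Wx; apply: (VW (k, x)); split => //=.
by apply: dV; rewrite -ball_normE /= sub0r normrN.
Qed.

Lemma nbhs0_absorb U : nbhs 0 U -> forall x, exists2 k : K, k != 0 & U (k *: x).
Proof.
move=> U0 x; have := @scale_continuous K E (0, x) U; rewrite /= scale0r.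
move=> /(_ U0)[[V W]] /= [V0 W0] VW.
have /nbhs_ballP[d d0 dV] := V0; have d20 : 0 < d / 2 by rewrite divr_gt0.
exists (d / 2); first by rewrite gt_eqF.
apply: (VW (d / 2, x)); split => /=; last exact: nbhs_singleton.
apply: dV; rewrite -ball_normE /= sub0r normrN gtr0_norm//.
by rewrite ltr_pdivrMr// ltr_pMr// ltr1n.
Qed.

(** The circled core [V] of a convex neighborhood is again convex. Joint continuity of scaling at
    [(0, 0)] puts a multiple of a neighborhood of 0 inside it. *)
Lemma nbhs0_disk U : nbhs 0 U -> exists V, [/\ nbhs 0 V, disk V & V `<=` U].
Proof.
have [B Bc [Bo Bb]] := @locally_convex K E.
move=> /(Bb 0)[b [Bb' b0 bU]].
have bc := Bc _ (mem_set Bb').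
have b_nbhs : nbhs 0 b by apply: open_nbhs_nbhs; split => //; exact: Bo.
have [d d0 [W W0 Wb]] := nbhs0_circled b_nbhs.
pose V := [set x | forall k : K, `|k| <= 1 -> b (k *: x)].
exists V; split; last by move=> x /(_ 1); rewrite normr1 scale1r => /(_ (lexx _))/bU.
  have d20 : 0 < d / 2 by rewrite divr_gt0.
  apply: filterS (nbhs0_scale (invr_neq0 (lt0r_neq0 d20)) W0) => x /= Wx k k1.
  have -> : k *: x = (k * (d / 2)) *: ((d / 2)^-1 *: x).
    by rewrite scalerA mulfK// gt_eqF.
  apply: Wb => //; rewrite normrM (gtr0_norm d20); apply: le_lt_trans (ler_piMl (ltW d20) k1) _.
  by rewrite ltr_pdivrMr// ltr_pMr// ltr1n.
apply: convex_circled_disk.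
- by move=> k _; rewrite scaler0.
- move=> x y l; rewrite !inE => Vx Vy k k1.
  have := bc (k *: x) (k *: y) l; rewrite !inE => /(_ (Vx _ k1) (Vy _ k1)).
  rewrite !conv_lmodE.
  by rewrite scalerDr !scalerA ![k * _]mulrC -!scalerA.
- move=> k k1 x Vx l l1; rewrite scalerA; apply: Vx.
  by rewrite normrM mulr_ile1.
Qed.

Lemma closureP0 D x : closure D x <->
  forall U, nbhs 0 U -> exists2 y, U y & D (x + y).
Proof.
split=> [Dx U U0|Dx B /nbhs_shift/Dx[y By Dxy]]; last by exists (x + y).
have /Dx[y [Dy Uy]] : nbhs x [set y | U (y - x)].
  by apply/nbhs_shift; apply: filterS U0 => y /=; rewrite addrAC subrr add0r.
by exists (y - x); rewrite // addrC subrK.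
Qed.

Lemma closureD_sub D U x : nbhs 0 U -> closure D x ->
  exists d u, [/\ D d, U u & x = d + u].
Proof.
move=> U0 /closureP0 /(_ [set y | U (- y)])[|y Uy Dxy].
  by have := nbhs0N U0; apply: filterS => _ [y Uy <-] /=; rewrite opprK.
by exists (x + y), (- y); rewrite addrK.
Qed.

Lemma disk_closure D : disk D -> disk (closure D).
Proof.
move=> dD; split; first by apply: subset_closure; exact: dD.1.
move=> a b x y ab /closureP0 Dx /closureP0 Dy; apply/closureP0 => U.
move=> /nbhs0_disk[V [V0 dV VU]].
have [x' Vx' Dx'] := Dx V V0; have [y' Vy' Dy'] := Dy V V0.
exists (a *: x' + b *: y'); first by apply: VU; exact: dV.2.
by rewrite addrACA -!scalerDr; exact: dD.2.
Qed.

Lemma nbhs0_closed_disk U : nbhs 0 U ->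
  exists V, [/\ nbhs 0 V, disk V, closed V & V `<=` U].
Proof.
move=> /nbhs0_add[W W0 WU]; have [V [V0 dV VW]] := nbhs0_disk W0.
exists (closure V); split; [|exact: disk_closure|exact: closed_closure|].
  by apply: filterS V0; exact: subset_closure.
move=> x /(closureD_sub V0)[d [u [Vd Vu ->]]].
by apply: WU; exact: VW.
Qed.

Lemma kolmogorov_nbhs0 : kolmogorov_space E <->
  forall x, (forall U, nbhs 0 U -> U x) -> x = 0.
Proof.
split=> [T0 x Ux|T0 x y xy].
  apply/eqP/negP => /negP/T0[U [[/set_mem Ux0 /set_mem nU]|[/set_mem U0 /set_mem nU]]].
    (* T0 does not say which of the two points is in [U]. If it is [x], the reflected set [x - U] is
       a neighborhood of 0 that misses [x]. *)
    apply: nU; have := Ux [set y | U (x - y)]; rewrite /= subrr; apply.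
    have /nbhs_shift/nbhs0N := Ux0.
    by apply: filterS => _ [y Uy <-]; rewrite /= opprK.
  by apply: nU; exact: Ux.
have [U U0 nUxy] : exists2 U, nbhs 0 U & ~ U (y - x).
  apply: contrapT => nU; move/eqP: xy; apply; apply/esym/subr0_eq/T0 => U U0.
  by apply: contrapT => nUxy; apply: nU; exists U.
exists [set z | U (z - x)]; left; split; rewrite inE//.
by apply/nbhs_shift; apply: filterS U0 => z /=; rewrite addrAC subrr add0r.
Qed.

End TvsTheory.

Section LinearMaps.
Context (K : numFieldType) (E F : tvsType K) (u : {linear E -> F}).

Lemma linear_continuous0 : continuous u <-> forall V, nbhs 0 V -> nbhs 0 (u @^-1` V).
Proof.
split=> [cu V V0|cu x V /nbhs_shift/cu V0]; first by apply: cu; rewrite linear0.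
by apply/nbhs_shift; apply: filterS V0 => y /=; rewrite linearD.
Qed.

Lemma disk_preimage (D : set F) : disk D -> disk (u @^-1` D).
Proof.
move=> dD; split; first by rewrite /preimage/= linear0; exact: dD.1.
by move=> a b x y ab Dx Dy; rewrite /preimage/= linearP linearZ; exact: dD.2.
Qed.

Lemma disk_image (D : set E) : disk D -> disk (u @` D).
Proof.
move=> dD; split; first by exists 0; rewrite ?linear0//; exact: dD.1.
move=> a b _ _ ab [x Dx <-] [y Dy <-]; exists (a *: x + b *: y); first exact: dD.2.
by rewrite linearP linearZ.
Qed.

(** Openness onto the range, tested at 0 only. Points of the range are written [u x], so no
    intersection with [range u] appears. *)
Definition open_at0 : Prop := forall U : set E, nbhs 0 U ->
  exists2 V : set F, nbhs 0 V & forall x, V (u x) -> exists2 y, U y & u y = u x.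

Lemma nearly_openP : nearly_open u <-> forall U : set E, nbhs 0 U ->
  exists2 V : set F, nbhs 0 V & forall x, V (u x) -> closure (u @` U) (u x).
Proof.
split=> [nu U /nu|nu U /nu[V V0 VU]].
  by rewrite /within/= => H; exists [set y | range u y -> closure (u @` U) y] => // x; apply; exists x.
by rewrite /within/=; apply: filterS V0 => y Vy [x _ xy]; rewrite -xy; apply: VU; rewrite xy.
Qed.

End LinearMaps.

Section HahnBanachTvs.
Context (R : realType) (K : numFieldType) (KRC : real_or_complex R K).
Context (E : tvsType K).

(** A point outside the closure of [D] is outside [D + U] for some disk neighborhood [U] of 0, and
    the bound on [U] given by the strict separation makes the functional continuous. *)
Lemma hahn_banach_tvs (D : set E) x0 : disk D -> ~ closure D x0 ->
  exists2 f : {linear E -> K^o}, continuous f &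
    (forall x, D x -> `|f x| <= 1) /\ 1 < `|f x0|.
Proof.
move=> dD nD; have [U0 [U0nbhs nU]] : exists U, nbhs 0 U /\ forall y, U y -> ~ D (x0 + y).
  apply: contrapT => nU; apply: nD; apply/closureP0 => U U0.
  apply: contrapT => H; apply: nU; exists U; split => // y Uy Dy.
  by apply: H; exists y.
have [U [Un dU UU0]] := nbhs0_disk U0nbhs.
have [||f lf [fD fU fx0]] := hahn_banach_strict KRC (x0 := x0) dD dU.
- exact: nbhs0_absorb.
- move=> x y Dx Uy xy; apply: (nU (- y)); last by rewrite xy addrK.
  by apply: UU0; exact: diskN.
pose g : {linear E -> K^o} := HB.pack f (GRing.isLinear.Build K E K^o *:%R f lf).
have gZ (a : K) x : f (a *: x) = a * f x by exact: (linearZ_LR g).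
exists g => //; apply/linear_continuous0 => V /nbhs_ballP[e e0 eV].
have e30 : 0 < e / 3 by rewrite divr_gt0.
apply: filterS (nbhs0_scale (invr_neq0 (lt0r_neq0 e30)) Un) => x /= /fU.
rewrite gZ normrM gtr0_norm ?invr_gt0// ler_pdivrMl// => fx.
apply: eV; rewrite -ball_normE/= sub0r normrN; apply: le_lt_trans fx _.
by rewrite mulrAC ltr_pdivrMr// ltr_pM2l// ltr_nat.
Qed.

End HahnBanachTvs.

(** * Weak-* closed subspaces of the dual *)

(** The product divided by the sum stands in for a minimum, since the order of [K] may be
    partial. *)
Lemma pos_lower_bound (K : numFieldType) (a b : K) : 0 < a -> 0 < b ->
  exists c, [/\ 0 < c, c <= a & c <= b].
Proof.
move=> a0 b0; have ab0 : 0 < a + b by exact: addr_gt0.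
exists (a * b / (a + b)); split; first by rewrite divr_gt0// mulr_gt0.
  by rewrite ler_pdivrMr// ler_pM2l// lerDr ltW.
by rewrite ler_pdivrMr// mulrC ler_pM2l// lerDl ltW.
Qed.

Section SetPred.
Context (K : numFieldType) (V : lmodType K).

Definition linear_set (P : set V) : Prop :=
  P 0 /\ forall (k : K) x y, P x -> P y -> P (k *: x + y).

(** The proof of linearity is an argument of the predicate, so that the [submodClosed] structure can
    be inferred from the term. *)
Definition set_pred (P : set V) (linP : linear_set P) : {pred V} := [pred x | `[< P x >]].

Fact set_pred_submod_closed (P : set V) (linP : linear_set P) :
  submod_closed (set_pred linP).
Proof.
split; first exact: (asboolT linP.1).
by move=> k x y /asboolP Px /asboolP Py; apply/asboolP; exact: linP.2.
Qed.

HB.instance Definition _ (P : set V) (linP : linear_set P) :=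
  GRing.isSubmodClosed.Build K V (set_pred linP) (set_pred_submod_closed linP).

Lemma set_predE (P : set V) (linP : linear_set P) : [set` set_pred linP] = P.
Proof. by apply/seteqP; split=> x /=; [move/asboolP|move=> ?; exact/asboolP]. Qed.

Lemma linear_set_pred (A : submodClosed V) : linear_set [set` A].
Proof. by split; [exact: rpred0|move=> k x y /= Ax Ay; rewrite rpredD ?rpredZ]. Qed.

End SetPred.

Section DualTheory.
Context (K : numFieldType) (E : tvsType K).
Implicit Types (f g : dual E) (Q : set (dual E)) (s : seq E).

Definition dual_fun f : E -> K^o := val f.

Lemma dual_fun_linear f : linear (dual_fun f).
Proof. by have [] := asboolW (valP f). Qed.

HB.instance Definition _ f := GRing.isLinear.Build K E K^o *:%R (dual_fun f)
  (dual_fun_linear f).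

Lemma dual_fun_continuous f : continuous (dual_fun f).
Proof. by have [] := asboolW (valP f). Qed.

Definition mk_dual (h : {linear E -> K^o}) (ch : continuous h) : dual E :=
  exist _ (h : E -> K^o) (asboolT (conj (@linearP _ _ _ _ h) ch)).

Lemma mk_dualE (h : {linear E -> K^o}) (ch : continuous h) x :
  dual_fun (mk_dual ch) x = h x.
Proof. by []. Qed.

Lemma dual_eq f g : dual_fun f = dual_fun g -> f = g.
Proof. exact: val_inj. Qed.

Lemma dual_funD f g x : dual_fun (f + g) x = dual_fun f x + dual_fun g x.
Proof. by []. Qed.

Lemma dual_funZ (k : K) f x : dual_fun (k *: f) x = k * dual_fun f x.
Proof. by []. Qed.

Lemma dual_fun0 x : dual_fun (0 : dual E) x = 0.
Proof. by []. Qed.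

Lemma functional_continuous (h : {linear E -> K^o}) (U : set E) (M : K) :
  nbhs 0 U -> 0 < M -> (forall x, U x -> `|h x| <= M) -> continuous h.
Proof.
move=> U0 M0 hM; apply/linear_continuous0 => V /nbhs_ballP[e /= e0 eV].
have k0 : 0 < e / (2 * M) by rewrite divr_gt0// mulr_gt0.
apply: filterS (nbhs0_scale (invr_neq0 (lt0r_neq0 k0)) U0) => x /= /hM.
have -> : h ((e / (2 * M))^-1 *: x) = (e / (2 * M))^-1 * h x by exact: linearZ_LR.
rewrite normrM gtr0_norm ?invr_gt0// ler_pdivrMl// => hx.
apply: eV; rewrite -ball_normE/= sub0r normrN; apply: le_lt_trans hx _.
rewrite invfM mulrA mulfVK ?gt_eqF//.
by rewrite ltr_pdivrMr// ltr_pMr// ltr1n.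
Qed.

Lemma continuous_functional_nbhs0 (h : {linear E -> K^o}) (M : K) :
  continuous h -> 0 < M -> nbhs 0 [set x | `|h x| <= M].
Proof.
move=> /linear_continuous0 ch M0; have /ch : nbhs (0 : K^o) [set y | `|y| <= M].
  by apply/nbhs_ballP; exists M => // y; rewrite -ball_normE/= sub0r normrN => /ltW.
exact: filterS.
Qed.

Definition pointwise_near (g : E -> K^o) s (e : K) : set (E -> K^o) :=
  [set h | forall x, x \in s -> `|h x - g x| < e].

(** The sets [pointwise_near g s e] generate a filter [F] that converges to [g] at every point,
    hence in the pointwise topology; so [F] contains every neighborhood of [g]. *)
Lemma ptws_nbhsP (g : {ptws E -> K^o}) W : nbhs g W <->
  exists s, exists2 e : K, 0 < e & pointwise_near g s e `<=` W.
Proof.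
split; last first.
  move=> [s [e e0 sW]]; apply: (filterS (F := nbhs g) sW).
  elim: s {sW} => [|x s IH]; first by apply: (filterS (F := nbhs g)) (filterT (F := nbhs g)) => h _ x; rewrite in_nil.
  have xe : nbhs g [set h : {ptws E -> K^o} | `|h x - g x| < e].
    have /= := @proj_continuous E (fun=> K^o) x g [set y | `|y - g x| < e].
    apply; apply/nbhs_ballP; exists e => // y; rewrite -ball_normE/= distrC.
    exact.
  apply: (filterS (F := nbhs g)) (filterI xe IH) => h [hx hs] y; rewrite inE => /orP[/eqP->//|].
  exact: hs.
pose F : set_system (E -> K^o) :=
  [set W | exists s, exists2 e : K, 0 < e & pointwise_near g s e `<=` W].
have FF : Filter F.
  split.
  - by exists [::], 1.
  - move=> A B [s [e e0 sA]] [t [d d0 tB]].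
    have [c [c0 ce cd]] := pos_lower_bound e0 d0.
    exists (s ++ t), c => // h hst; split; [apply: sA|apply: tB] => x xs.
      by apply: lt_le_trans ce; apply: hst; rewrite mem_cat xs.
    by apply: lt_le_trans cd; apply: hst; rewrite mem_cat xs orbT.
  - by move=> A B AB [s [e e0 sA]]; exists s, e => // h /sA/AB.
have /pointwise_cvgP : forall t : E, (fun h : E -> K^o => h t) @ F --> g t.
  move=> t V /nbhs_ballP[e /= e0 eV]; exists [:: t], e => // h /(_ t).
  rewrite inE eqxx => /(_ isT) ht; apply: eV.
  by rewrite -ball_normE/= distrC.
by apply.
Qed.

Lemma dual_closureP Q g : closure Q g <-> forall s (e : K), 0 < e ->
  exists2 f, Q f & forall x, x \in s -> `|dual_fun f x - dual_fun g x| < e.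
Proof.
split=> [Qg s e e0|Qg B].
  have /Qg[f [Qf fg]] : nbhs g [set f | pointwise_near (dual_fun g) s e (dual_fun f)].
    apply: (@initial_continuous (dual E) {ptws E -> K^o} val g).
    by apply/ptws_nbhsP; exists s, e.
  by exists f.
move=> [_ [[W oW <-] /= Wg] WB].
have /ptws_nbhsP[s [e e0 sW]] : nbhs (val g : {ptws E -> K^o}) W by exact: open_nbhs_nbhs.
have [f Qf fg] := Qg s e e0; exists f; split => //; apply: WB => /=.
exact: sW.
Qed.

Lemma equicontinuousP (A : set (dual E)) : equicontinuous A (\val : dual E -> E -> K^o) <->
  exists2 U, nbhs 0 U & forall f x, A f -> U x -> `|dual_fun f x| <= 1.
Proof.
split=> [eA|[U U0 AU] x W].
  have entW : entourage [set z : K^o * K^o | `|z.1 - z.2| < 1].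
    by rewrite -entourage_from_ballE; exists 1 => //= z; rewrite -ball_normE.
  exists [set y | forall f, A f -> `|dual_fun f y| <= 1]; last by move=> f x Af; exact.
  have := eA 0 _ entW; apply: filterS => y Ay f Af.
  by have := Ay f Af; rewrite /= -/(dual_fun f) linear0 sub0r normrN => /ltW.
rewrite -entourage_from_ballE => -[e /= e0 eW].
have k0 : 0 < e / 2 by rewrite divr_gt0.
apply/nbhs_shift; apply: filterS (nbhs0_scale (invr_neq0 (lt0r_neq0 k0)) U0) => y /= Uy f Af.
apply: eW; rewrite -ball_normE /= -!/(dual_fun f) -linearB opprD addrA subrr sub0r linearN normrN.
have := AU f _ Af Uy.
have -> : dual_fun f ((e / 2)^-1 *: y) = (e / 2)^-1 * dual_fun f y by exact: linearZ_LR.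
rewrite normrM gtr0_norm ?invr_gt0// ler_pdivrMl// mulr1 => /le_lt_trans; apply.
by rewrite ltr_pdivrMr// ltr_pMr// ltr1n.
Qed.

(** Gaussian elimination on the points. If some member of [Q] does not vanish at [y], it is
    normalized to [f1] with value 1 there, and the other points are moved along [y] into the kernel
    of [f1]; a multiple of [f1] then corrects the value at [y]. The induction is on the size because
    the list changes. *)
Lemma dual_interpolation Q g s : linear_set Q ->
  (exists2 f, Q f & forall x, x \in s -> dual_fun f x = dual_fun g x) \/
  (exists y, (forall f, Q f -> dual_fun f y = 0) /\ dual_fun g y <> 0).
Proof.
move=> linQ; have [n] := ubnP (size s); elim: n s => // n IH [|y s] /=.
  by move=> _; left; exists 0; [exact: linQ.1|].
rewrite ltnS => sn.
have [Qy|] := pselect (forall f, Q f -> dual_fun f y = 0).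
  have [[f Qf fg]|] := IH s sn; last by right.
  have [gy|gy] := eqVneq (dual_fun g y) 0; last by right; exists y; split => //; exact/eqP.
  by left; exists f => // x; rewrite inE => /orP[/eqP->|/fg//]; rewrite Qy// gy.
move=> /existsNP[f0 /not_implyP[Qf0 /eqP f0y]].
pose f1 := (dual_fun f0 y)^-1 *: f0.
have Qf1 : Q f1 by have := linQ.2 (dual_fun f0 y)^-1 f0 0 Qf0 linQ.1; rewrite addr0.
have f1y : dual_fun f1 y = 1 by rewrite dual_funZ mulVf.
pose r x := x - dual_fun f1 x *: y.
have rE f x : dual_fun f (r x) = dual_fun f x - dual_fun f1 x * dual_fun f y.
  by rewrite linearB; congr (_ - _); exact: linearZ_LR.
have [|[f Qf fg]|] := IH [seq r x | x <- s]; first by rewrite size_map.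
  left; exists ((dual_fun g y - dual_fun f y) *: f1 + f); first exact: linQ.2.
  move=> x; rewrite inE => /orP[/eqP->|xs]; rewrite dual_funD dual_funZ.
    by rewrite f1y mulr1 subrK.
  have := fg _ (map_f r xs); rewrite !rE => /eqP; rewrite subr_eq => /eqP ->.
  by rewrite mulrBl [dual_fun f1 x * _]mulrC [dual_fun f1 x * _]mulrC; ring.
by right.
Qed.

(* The hypothesis of [ptak], restricted to the equicontinuous sets that are
   polars of neighborhoods of [0]. *)
Definition almost_closed Q : Prop := forall U g, nbhs 0 U ->
  (forall x, U x -> `|dual_fun g x| <= 1) ->
  (forall s (e : K), 0 < e -> exists2 f,
     Q f /\ (forall x, U x -> `|dual_fun f x| <= 1) &
     forall x, x \in s -> `|dual_fun f x - dual_fun g x| < e) -> Q g.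

(** By interpolation at finitely many points, a weak-* closed linear subspace contains every
    functional that vanishes on its annihilator. So for an almost closed [Q], being closed can be
    replaced with this algebraic condition. *)
Lemma ptakP : ptak E <-> forall Q, linear_set Q -> almost_closed Q ->
  forall g, (forall y, (forall f, Q f -> dual_fun f y = 0) -> dual_fun g y = 0) -> Q g.
Proof.
split=> [ptakE Q linQ acQ g gQ|H Q acQ].
  have : closed [set` set_pred linQ].
    apply: ptakE => A /equicontinuousP[U U0 AU]; rewrite set_predE.
    apply/closed_subspaceP; exists (closure (Q `&` A)); first exact: closed_closure.
    apply/seteqP; split=> f [Qf Af]; last first.
      by split => //; exact: subset_closure.
    split=> //; split => //; apply: (acQ U) => // [x|s e e0]; first exact: AU.
    have /dual_closureP/(_ s e e0)[h [Qh Ah] hf] := Qf.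
    by exists h => //; split => // x; exact: AU.
  rewrite set_predE => /closure_id ->; apply/dual_closureP => s e e0.
  have [[f Qf fg]|[y [Qy gy]]] := dual_interpolation g s linQ; last by have := gQ y Qy.
  by exists f => // x /fg ->; rewrite subrr normr0.
apply/closure_id/seteqP; split; first exact: subset_closure.
move=> g /dual_closureP Qg; apply: H => //; [exact: linear_set_pred| |].
- move=> U h U0 hU Qh; pose A := [set f : dual E | forall x, U x -> `|dual_fun f x| <= 1].
  have /acQ/closed_subspaceP[C cC CE] : equicontinuous A (\val : dual E -> E -> K^o).
    by apply/equicontinuousP; exists U => // f x Af; exact: Af.
  have : (C `&` A) h.
    split => //; apply: cC; apply/dual_closureP => s e e0.
    have [f [Qf Uf] fh] := Qh s e e0; exists f => //.
    by have : ([set` Q] `&` A `&` A) f by []; rewrite -CE => -[].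
  by rewrite CE => -[[]].
- move=> y Qy; apply/eqP/negP => /negP gy0.
  have [|f Qf] := Qg [:: y] `|dual_fun g y|; first by rewrite normr_gt0.
  by move=> /(_ y); rewrite inE eqxx Qy// sub0r normrN ltxx => /(_ isT).
Qed.

End DualTheory.

(** * Topologies defined by a base of disks *)

(** Conditions for a family of disks to be a base at 0 of a locally convex topology. Stability under
    dilation, [base_scale], gives continuity of addition, through midpoints, and of scaling. *)
Record disk_base (K : numFieldType) (V : lmodType K) := DiskBase {
  base_sets : set (set V);
  base_nonempty : base_sets !=set0;
  base_disk : forall D, base_sets D -> disk D;
  base_absorb : forall D x, base_sets D -> exists2 k : K, k != 0 & D (k *: x);
  base_inter : forall C D, base_sets C -> base_sets D ->
    exists2 B, base_sets B & B `<=` C `&` D;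
  base_scale : forall D (k : K), base_sets D -> k != 0 ->
    exists2 C, base_sets C & forall x, C x -> D (k *: x)
}.

Definition disk_base_tvs (K : numFieldType) (V : lmodType K) (B : disk_base V) : Type := V.

Section DiskBaseTvs.
Context (K : numFieldType) (V : lmodType K) (B : disk_base V).

Local Notation F := (disk_base_tvs B).
Local Notation base := (base_sets B).

HB.instance Definition _ := GRing.Lmodule.on F.

Definition disk_base_nbhs (x : F) : set_system F :=
  [set W | exists2 D, base D & forall y, D y -> W (x + y)].

HB.instance Definition _ := hasNbhs.Build F disk_base_nbhs.

Lemma disk_baseD D : base D -> exists2 C, base C & forall x y, C x -> C y -> D (x + y).
Proof.
move=> BD; have n2 : (2 : K) != 0 by rewrite pnatr_eq0.
have [C BC CD] := base_scale BD n2; exists C => // x y Cx Cy.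
have := CD _ (disk_half (base_disk BC) Cx Cy).
by rewrite scalerDr !scalerA divff// !scale1r.
Qed.

Fact disk_base_nbhs_filter (x : F) : ProperFilter (nbhs x).
Proof.
split.
  move=> [D BD /(_ 0)]; apply; exact: (base_disk BD).1.
split.
- by have [D BD] := base_nonempty B; exists D.
- move=> P Q [C BC CP] [D BD DQ]; have [A BA ACD] := base_inter BC BD.
  by exists A => // y /ACD[Cy Dy]; split; [exact: CP|exact: DQ].
- by move=> P Q PQ [D BD DP]; exists D => // y /DP/PQ.
Qed.

Fact disk_base_nbhs_singleton (x : F) (W : set F) : nbhs x W -> W x.
Proof. by move=> [D BD /(_ 0)]; rewrite addr0; apply; exact: (base_disk BD).1. Qed.

Fact disk_base_nbhs_nbhs (x : F) (W : set F) : nbhs x W -> nbhs x (nbhs^~ W).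
Proof.
move=> [D BD DW]; have [C BC CD] := disk_baseD BD.
by exists C => // y Cy; exists C => // z Cz; rewrite -addrA; apply: DW; exact: CD.
Qed.

HB.instance Definition _ := Nbhs_isNbhsTopological.Build F
  disk_base_nbhs_filter disk_base_nbhs_singleton disk_base_nbhs_nbhs.

Fact disk_base_add_continuous : continuous (fun x : F * F => x.1 + x.2).
Proof.
move=> [x y] W [D BD DW]; have [C BC CD] := disk_baseD BD.
exists ([set z | C (z - x)], [set z | C (z - y)]).
  by split; exists C => // z Cz /=; rewrite addrAC subrr add0r.
move=> [a b] /= [Ca Cb].
have -> : a + b = (x + y) + ((a - x) + (b - y)).
  by rewrite [a - x + _]addrACA -opprD [RHS]addrC subrK.
by apply: DW; exact: CD.
Qed.

Fact disk_base_scale_continuous : continuous (fun z : K^o * F => z.1 *: z.2).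
Proof.
move=> [k x] W [D BD DW]; have [C BC CD] := disk_baseD BD.
(* The difference [l *: y - k *: x] splits into [(l - k) *: x] and [l *: (y - x)]. For
   [|k - l| < |c|] the first part is absorbed by [C], and [|l|] is below the factor [|k| + |c|] used
   to choose [A]. *)
have [c c0 Ccx] := @base_absorb _ _ B C x BC; have nc : 0 < `|c| by rewrite normr_gt0.
have M0 : 0 < `|k| + `|c| by rewrite ltr_wpDl.
have [A BA AC] := base_scale BC (lt0r_neq0 M0).
exists ([set l | `|k - l| < `|c|], [set z | A (z - x)]).
  split; last by exists A => // z Az /=; rewrite addrAC subrr add0r.
  by apply/nbhs_ballP; exists `|c| => // l; rewrite -ball_normE.
move=> [l y] /= [kl Ayx].
have -> : l *: y = k *: x + ((l - k) *: x + l *: (y - x)).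
  by rewrite addrA -scalerDl [k + _]addrC subrK -scalerDr [x + _]addrC subrK.
apply: DW; apply: CD.
  by apply: (diskZ (base_disk BC) _ Ccx); rewrite distrC ltW.
apply: (diskZ (base_disk BC) _ (AC _ Ayx)); rewrite (gtr0_norm M0) -lerBlDl.
by apply: le_trans (lerB_dist _ _) _; rewrite distrC ltW.
Qed.

Fact disk_base_locally_convex : exists2 S : set_system F,
  (forall b, b \in S -> convex_set b) & basis S.
Proof.
exists [set W | open W /\ convex_set W]; first by move=> b /[!inE] -[].
split; first by move=> W [].
(* The disks of the base need not be open, so the basic set is the interior of a translated disk. It
   is convex since one base set can serve both endpoints of a segment. *)
move=> x W [D BD DW]; pose C := [set y : F | D (y - x)].
exists C°; last first.
  by move=> y /interior_subset; rewrite /C/= => /DW; rewrite addrC subrK.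
split; last by exists D => // y Dy; rewrite /C/= addrAC subrr add0r.
split; first exact: open_interior.
move=> y z l /[!inE] -[D1 B1 Dy] [D2 B2 Dz].
have [A BA A12] := base_inter B1 B2; exists A => // w /A12[/Dy/= Cy /Dz/= Cz].
have := disk_convex (base_disk BD) l (mem_set Cy) (mem_set Cz).
rewrite inE !conv_lmodE /C/=; congr D.
rewrite !scalerDr addrACA -scalerDl addrACA -scalerDl [_ + (1 - _)]addrC subrK !scale1r.
by rewrite -!addrA.
Qed.

HB.instance Definition _ := PreTopologicalLmod_isTvs.Build K F
  disk_base_add_continuous disk_base_scale_continuous disk_base_locally_convex.
HB.instance Definition _ := PreTopologicalNmodule_isTopologicalNmodule.Build
  F disk_base_add_continuous.
HB.instance Definition _ := TopologicalNmodule_isTopologicalLmodule.Build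
  K F disk_base_scale_continuous.
HB.instance Definition _ := Uniform_isTvs.Build K F disk_base_locally_convex.

Lemma disk_base_nbhs0 (W : set F) : nbhs 0 W <-> exists2 D, base D & D `<=` W.
Proof.
by split=> -[D BD DW]; exists D => // y /DW; rewrite add0r.
Qed.

End DiskBaseTvs.

(** * A criterion for Ptak spaces *)

Section QuotientMap.
Context (K : numFieldType) (E : tvsType K) (A : submodClosed E).

Definition quot_map : E -> tvs_quot A := \pi_(tvs_quot A)%qT.

Fact quot_map_linear : linear quot_map.
Proof. by move=> k x y; rewrite /quot_map tvs_quot_piD tvs_quot_piZ. Qed.

HB.instance Definition _ := GRing.isLinear.Build K E (tvs_quot A) *:%R quot_map
  quot_map_linear.

Lemma quot_map_surj y : exists x, quot_map x = y.
Proof. by have [x ->] := tvs_quot_pi_surj y; exists x. Qed.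

Lemma quot_map_eq0 x : quot_map x = 0 <-> x \in A.
Proof. by rewrite -(linear0 quot_map) -[x in x \in A]subr0; exact: tvs_quot_eq_pi. Qed.

Lemma quot_map_continuous : continuous quot_map.
Proof. exact: tvs_quot_pi_continuous. Qed.

Lemma quot_map_nbhs0 U : nbhs 0 U -> nbhs 0 (quot_map @` U).
Proof. by rewrite -[X in _ -> nbhs X _](linear0 quot_map); exact: tvs_quot_pi_nbhs. Qed.

Lemma tvs_quot_kolmogorov : closed [set` A] -> kolmogorov_space (tvs_quot A).
Proof.
move=> cA; apply/kolmogorov_nbhs0 => y; have [x <-] := quot_map_surj y => xU.
apply/quot_map_eq0; apply: (cA); apply/closureP0 => U U0.
have /xU[z Uz zx] : nbhs 0 (quot_map @` [set y | U (- y)]).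
  by apply: quot_map_nbhs0; have := nbhs0N U0; apply: filterS => _ [w Uw <-] /=; rewrite opprK.
by exists (- z) => //; apply/quot_map_eq0; rewrite linearB/= zx subrr.
Qed.

End QuotientMap.

Section PtakOfOpen.
Context (R : realType) (K : numFieldType) (KRC : real_or_complex R K).
Context (E : tvsType K).
Implicit Types (Q : set (dual E)) (U W : set E).

Definition polar U : set (dual E) := [set f | forall x, U x -> `|dual_fun f x| <= 1].

(** A functional on [E -> K] that depends only on the values at finitely many points acts on linear
    maps as evaluation at one vector. This turns a separating functional on the function space into
    a point of [E]; [undup] counts each point once. *)
Lemma linear_fun_sum_delta (L : (E -> K^o) -> K^o) (s : seq E) (f : {linear E -> K^o}) :
  linear L -> (forall h : E -> K^o, (forall x, x \in s -> h x = 0) -> L h = 0) ->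
  L f = f (\sum_(x <- undup s) (L (fun y => (y == x)%:R) : K) *: x).
Proof.
move=> linL Ls; pose g : {linear (E -> K^o) -> K^o} :=
  HB.pack L (GRing.isLinear.Build K (E -> K^o) K^o *:%R L linL).
pose d (x : E) : E -> K^o := fun y => (y == x)%:R.
have sE y : (\sum_(x <- undup s) f x *: d x) y = \sum_(x <- undup s) f x * d x y.
  by rewrite fct_sumE.
have /Ls : forall y, y \in s -> ((f : E -> K^o) - \sum_(x <- undup s) f x *: d x) y = 0.
  move=> y ys; rewrite -[LHS]/(f y - (\sum_(x <- undup s) f x *: d x) y) sE.
  rewrite (bigD1_seq y)/= ?mem_undup ?undup_uniq// big1 ?addr0.
    by rewrite /d eqxx mulr1 subrr.
  by move=> x xy; rewrite /d eq_sym (negbTE xy) mulr0.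
rewrite -[L]/(g : (E -> K^o) -> K^o) linearB linear_sum => /subr0_eq ->.
rewrite linear_sum; apply: eq_bigr => x _.
transitivity (f x * L (d x)); first exact: (linearZ_LR g).
by rewrite mulrC; symmetry; exact: linearZ_LR.
Qed.

(* Bipolar theorem for the disk of restrictions of [Q] to [W], in the space
   [E -> K] with the topology of pointwise convergence. *)
Lemma almost_closed_bipolar Q W g : linear_set Q -> almost_closed Q -> nbhs 0 W ->
  (forall x, (forall f, Q f -> polar W f -> `|dual_fun f x| <= 1) -> `|dual_fun g x| <= 1) ->
  Q g.
Proof.
move=> linQ acQ W0 gW; apply: (acQ W) => //.
  by move=> x Wx; apply: gW => f _; exact.
move=> s e e0; apply: contrapT => nf.
pose D := [set h | exists2 f, Q f /\ polar W f & h = dual_fun f].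
pose U := [set h : E -> K^o | forall x, x \in s -> `|h x| <= e / 2].
have e20 : 0 < e / 2 by rewrite divr_gt0.
have dD : disk D.
  split; first by exists 0 => //; split; [exact: linQ.1|move=> x _; rewrite dual_fun0 normr0].
  move=> a b _ _ ab [f1 [Q1 W1 ->]] [f2 [Q2 W2 ->]]; exists (a *: f1 + b *: f2) => //; split.
    by apply: linQ.2 => //; rewrite -[_ *: f2]addr0; apply: linQ.2 => //; exact: linQ.1.
  move=> x Wx; rewrite dual_funD !dual_funZ; apply: le_trans ab.
  by apply: le_trans (ler_normD _ _) _; rewrite !normrM lerD// ler_piMr// ?W1 ?W2.
have dU : disk U.
  split; first by move=> x _; rewrite normr0 ltW.
  move=> a b h1 h2 ab U1 U2 x xs; apply: le_trans (ler_normD _ _) _; rewrite !normrM.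
  apply: (@le_trans _ _ ((`|a| + `|b|) * (e / 2))); last by rewrite ler_piMl// ltW.
  by rewrite mulrDl lerD// ler_wpM2l ?U1 ?U2.
have aU : forall h, exists2 k : K, k != 0 & U (k *: h).
  move=> h; have [M M0 hM] : exists2 M, 0 < M & forall x, x \in s -> `|h x| <= M.
    elim: (s) => [|y t [M M0 hM]]; first by exists 1.
    exists (M + `|h y|); first by rewrite ltr_wpDr.
    move=> x; rewrite inE => /orP[/eqP->|/hM hx]; first by rewrite lerDr ltW.
    by rewrite ler_wpDr.
  exists (e / 2 / M); first by rewrite mulf_neq0 ?invr_neq0 ?gt_eqF.
  move=> x /hM hx; rewrite fctE normrM gtr0_norm ?divr_gt0//.
  apply: (@le_trans _ _ (e / 2 / M * M)); last by rewrite divfK// gt_eqF.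
  by rewrite ler_wpM2l// ltW// divr_gt0.
(* If [g] were in [D + U], its component in [D] would be one of the approximations that [nf]
   excludes. *)
have [|L linL [LD LU Lg]] := hahn_banach_strict KRC (x0 := dual_fun g) dD dU aU.
  move=> _ h [f [Qf Wf] ->] Uh gE; apply: nf; exists f => // x xs.
  rewrite gE fctE opprD addNKr normrN; apply: le_lt_trans (Uh x xs) _.
  by rewrite ltr_pdivrMr// ltr_pMr// ltr1n.
have LZ (c : K) h : L (c *: h) = c * L h.
  have L0 : L 0 = 0.
    by have := linL 1 0 0; rewrite scaler0 addr0 scale1r => /esym/eqP; rewrite -subr_eq0 addrK => /eqP.
  by have := linL c h 0; rewrite !addr0 L0 addr0.
have Ls (h : E -> K^o) : (forall x, x \in s -> h x = 0) -> L h = 0.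
  (* [U] contains every multiple of a function vanishing on [s], and a multiple with value 3 would
     violate the bound 2 on [U]. *)
  move=> h0; apply/eqP/negP => /negP Lh; have := LU ((3 / L h) *: h).
  rewrite LZ divfK// ger0_norm// ler_nat/= => H.
  suff : false by []; apply: H => x xs.
  by rewrite fctE h0// scaler0 normr0 ltW.
have := gW (\sum_(x <- undup s) (L (fun y => (y == x)%:R) : K) *: x).
rewrite -linear_fun_sum_delta// => H.
suff : `|L (dual_fun g)| <= 1 by rewrite (lt_geF Lg).
apply: H => f Qf Wf; rewrite -linear_fun_sum_delta//; apply: LD.
by exists f.
Qed.

Section PolarTopology.
Context (Q : set (dual E)) (linQ : linear_set Q).

Definition annihilator : set E := [set x | forall f, Q f -> dual_fun f x = 0].

Lemma annihilator_linear : linear_set annihilator.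
Proof.
split; first by move=> f _; rewrite linear0.
by move=> k x y Qx Qy f Qf; rewrite linearD linearZ_LR/= Qx// Qy// scaler0 addr0.
Qed.

Local Notation A := (set_pred annihilator_linear).
Local Notation pi := (quot_map A).

Lemma annihilator_closed : closed [set` A].
Proof.
rewrite set_predE => x Ax f Qf; apply/eqP/negP => /negP fx.
have := continuous_functional_nbhs0 (@dual_fun_continuous _ _ f).
move=> /(_ (`|dual_fun f x| / 2)); rewrite divr_gt0 ?normr_gt0// => /(_ isT).
move=> /(closureD_sub)/(_ Ax)[a [y [Aa /= fy xE]]]; move: fy.
have -> : dual_fun f x = dual_fun f y by rewrite xE linearD/= Aa ?add0r.
have : 0 < `|dual_fun f y| by move: fx; rewrite xE linearD/= Aa ?add0r ?normr_gt0.
move=> fy0; rewrite ler_pdivlMr// ger_pMr// lern1 //.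
Qed.

(* These sets define the topology of uniform convergence on the sets
   [Q `&` polar W], which has dual [Q]. *)
Definition polar_set W : set (tvs_quot A) :=
  [set y | exists2 x, y = pi x & forall f, Q f -> polar W f -> `|dual_fun f x| <= 1].

Lemma polar_setP W x : polar_set W (pi x) <->
  forall f, Q f -> polar W f -> `|dual_fun f x| <= 1.
Proof.
split=> [[y xy Hy] f Qf Wf|Hx]; last by exists x.
have /quot_map_eq0 : pi (x - y) = 0 by rewrite linearB/= xy subrr.
move=> /asboolP/(_ f Qf); rewrite linearB => /subr0_eq ->.
exact: Hy.
Qed.

Definition polar_base_sets : set (set (tvs_quot A)) :=
  [set polar_set W | W in nbhs (0 : E)].

Program Definition polar_base : disk_base (tvs_quot A) :=
  @DiskBase K (tvs_quot A) polar_base_sets _ _ _ _ _.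
Next Obligation. by exists (polar_set setT), setT => //; exact: filterT. Qed.
Next Obligation.
move=> _ [W W0 <-]; split.
  exists 0; first by rewrite linear0.
  by move=> f _ _; rewrite linear0 normr0.
move=> a b x y ab; have [{}x <-] := quot_map_surj x; have [{}y <-] := quot_map_surj y.
rewrite -!linearZ -linearD => /polar_setP Wx /polar_setP Wy; apply/polar_setP => f Qf Wf.
rewrite linearD !linearZ_LR; apply: le_trans (ler_normD _ _) _; rewrite !normrM.
apply: le_trans ab; rewrite lerD// ler_piMr//; [exact: Wx|exact: Wy].
Qed.
Next Obligation.
move=> _ x [W W0 <-]; have [{}x <-] := quot_map_surj x.
have [k k0 Wk] := nbhs0_absorb W0 x; exists k => //.
by rewrite -linearZ; apply/polar_setP => f _; exact.
Qed.
Next Obligation.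
move=> _ _ [U U0 <-] [W W0 <-]; exists (polar_set (U `&` W)).
  by exists (U `&` W) => //; exact: filterI.
move=> x; have [{}x <-] := quot_map_surj x => /polar_setP xUW.
by split; apply/polar_setP => f Qf Wf; apply: xUW => // z [Uz Wz]; exact: Wf.
Qed.
Next Obligation.
move=> _ k [W W0 <-] k0; exists (polar_set [set x | W (k *: x)]).
  by exists [set x | W (k *: x)] => //; exact: nbhs0_scale.
move=> x; have [{}x <-] := quot_map_surj x => /polar_setP xW.
rewrite -linearZ; apply/polar_setP => f Qf Wf.
rewrite linearZ_LR -[X in `|X|]/(dual_fun (k *: f) x); apply: xW.
  by rewrite -[_ *: _]addr0; apply: linQ.2 => //; exact: linQ.1.
by move=> z /= /Wf; rewrite linearZ_LR.
Qed.

Definition polar_tvs : tvsType K := disk_base_tvs polar_base.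

Definition to_polar_tvs (x : tvs_quot A) : polar_tvs := x.

Fact to_polar_tvs_linear : linear to_polar_tvs. Proof. by []. Qed.

HB.instance Definition _ := GRing.isLinear.Build K (tvs_quot A) polar_tvs *:%R
  to_polar_tvs to_polar_tvs_linear.

Local Notation u := (to_polar_tvs : {linear tvs_quot A -> polar_tvs}).

Lemma polar_tvs_nbhs0 (V : set polar_tvs) : nbhs 0 V <->
  exists2 W, nbhs 0 W & polar_set W `<=` V.
Proof.
split=> [/disk_base_nbhs0[_ [W W0 <-] WV]|[W W0 WV]]; first by exists W.
by apply/disk_base_nbhs0; exists (polar_set W) => //; exists W.
Qed.

Lemma polar_tvs_kolmogorov : kolmogorov_space polar_tvs.
Proof.
apply/kolmogorov_nbhs0 => y yV; have [x xy] := quot_map_surj y.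
rewrite -xy; apply/quot_map_eq0; apply/asboolP => f Qf; apply/eqP/negP => /negP fx.
(* The functional [c *: f] takes the value 2 at [x] and is in the polar of [W], so [polar_set W]
   misses the class of [x]. *)
pose c := 2 / dual_fun f x; have c0 : c != 0 by rewrite mulf_neq0 ?invr_neq0 ?pnatr_eq0.
pose W := [set z | `|dual_fun f z| <= `|c|^-1].
have W0 : nbhs 0 W.
  by apply: continuous_functional_nbhs0; [exact: dual_fun_continuous|rewrite invr_gt0 normr_gt0].
have /yV : nbhs (0 : polar_tvs) (polar_set W) by apply/polar_tvs_nbhs0; exists W.
rewrite -xy => /polar_setP/(_ (c *: f)); rewrite dual_funZ divfK// normr_nat.
rewrite lern1 => H; suff : false by []; apply: H.
  by rewrite -[_ *: _]addr0; apply: linQ.2 => //; exact: linQ.1.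
move=> z Wz; rewrite dual_funZ normrM mulrC -ler_pdivlMr ?normr_gt0// div1r.
exact: Wz.
Qed.

Lemma to_polar_tvs_continuous : continuous u.
Proof.
apply/linear_continuous0 => V /polar_tvs_nbhs0[W W0 WV].
apply: filterS (quot_map_nbhs0 A W0) => _ [x Wx <-].
by apply: WV; apply/polar_setP => f _; exact.
Qed.

(** A continuous [h] is bounded by 1 on some [polar_set W], which is exactly the hypothesis of the
    bipolar lemma. *)
Lemma polar_tvs_dual (acQ : almost_closed Q) (h : {linear polar_tvs -> K^o}) (g : dual E) :
  continuous h -> (forall x, dual_fun g x = h (u (pi x))) -> Q g.
Proof.
move=> ch gE; have := continuous_functional_nbhs0 ch ltr01.
move=> /polar_tvs_nbhs0[W W0 Wh]; apply: (@almost_closed_bipolar Q W) => // x xW.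
by rewrite gE; apply: Wh; apply/polar_setP.
Qed.

(** If a point of the polar set of [M] were outside the closure of the image of [M], a separating
    functional would, pulled back to [E], lie in [Q] and in the polar of the preimage of [M], so it
    would be at most 1 at the point. *)
Lemma to_polar_tvs_nearly_open : almost_closed Q -> nearly_open u.
Proof.
move=> acQ; apply/nearly_openP => N /nbhs0_disk[M [M0 dM MN]].
have W0 : nbhs 0 (pi @^-1` M).
  by apply: (linear_continuous0 pi).1 => //; exact: quot_map_continuous.
exists (polar_set (pi @^-1` M)); first by apply/polar_tvs_nbhs0; exists (pi @^-1` M).
move=> y; have [{}y <-] := quot_map_surj y => /polar_setP yW.
suff : closure (u @` M) (u (pi y)) by apply: closureS; exact: image_subset.
apply: contrapT => ny.
have [h ch [hM hy]] := hahn_banach_tvs KRC (disk_image u dM) ny.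
pose k : {linear E -> K^o} := h \o (u \o pi).
have kM x : M (pi x) -> `|k x| <= 1 by move=> Mx; apply: hM; exists (pi x).
have ck : continuous k := functional_continuous W0 ltr01 kM.
have Qk : Q (mk_dual ck) by exact: polar_tvs_dual ch _.
suff : `|h (u (pi y))| <= 1 by rewrite (lt_geF hy).
exact: (yW (mk_dual ck)).
Qed.

End PolarTopology.

(** The hypothesis makes the polar topology on [E / A] as fine as the quotient topology. The
    neighborhood where [|g| <= 1] then contains a bipolar, up to elements of [A], on which [g]
    vanishes; the bipolar lemma puts [g] in [Q]. *)
Lemma ptak_of_open :
  (forall (A : submodClosed E) (F : tvsType K) (u : {linear tvs_quot A -> F}),
    closed [set` A] -> kolmogorov_space F -> injective u -> continuous u ->
    nearly_open u -> open_at0 u) -> ptak E.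
Proof.
move=> H; apply/ptakP => Q linQ acQ g gQ.
have cA := @annihilator_closed Q.
pose u : {linear tvs_quot (set_pred (annihilator_linear Q)) -> polar_tvs linQ} :=
  @to_polar_tvs Q linQ.
have ou : open_at0 u.
  apply: H => //; [exact: polar_tvs_kolmogorov|exact: to_polar_tvs_continuous|].
  exact: to_polar_tvs_nearly_open.
pose W := [set x | `|dual_fun g x| <= 1].
have W0 : nbhs 0 W by apply: continuous_functional_nbhs0; [exact: dual_fun_continuous|].
have [V /polar_tvs_nbhs0[U U0 UV] VW] := ou _ (quot_map_nbhs0 _ W0).
apply: (@almost_closed_bipolar Q U) => // x xU.
have [|_ [z Wz <-] zx] := VW (quot_map _ x).
  by apply: UV; apply/polar_setP.
have /quot_map_eq0/asboolP/gQ : quot_map (set_pred (annihilator_linear Q)) (z - x) = 0.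
  by rewrite linearB; apply/eqP; rewrite subr_eq0; apply/eqP.
by rewrite linearB/= => /subr0_eq <-.
Qed.

End PtakOfOpen.

(** * Open mapping and closed graph theorems for Ptak spaces *)

Section Functionals.
Context (K : numFieldType) (E : tvsType K).
Implicit Types (h : {linear E -> K^o}) (D : set E).

Lemma functional_eq0 h x : (forall k : K, `|h (k *: x)| <= 1) -> h x = 0.
Proof.
move=> hx; apply/eqP/negP => /negP h0; have := hx (2 / h x).
have -> : h ((2 / h x) *: x) = 2 / h x * h x by exact: linearZ_LR.
by rewrite divfK// normr_nat lern1.
Qed.

Lemma functional_closure_le1 h D : continuous h ->
  (forall x, D x -> `|h x| <= 1) -> forall x, closure D x -> `|h x| <= 1.
Proof.
move=> ch hD x Dx; apply/ler_addgt0Pr => e e0.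
have [d [y [/hD hd /= hy ->]]] := closureD_sub (continuous_functional_nbhs0 ch e0) Dx.
by rewrite linearD; apply: le_trans (ler_normD _ _) _; exact: lerD.
Qed.

Lemma disk_closure_barrel D : disk D -> (forall x, exists2 k : K, k != 0 & D (k *: x)) ->
  barrel (closure D).
Proof.
move=> dD aD; have dcD := disk_closure dD; split.
- exact: closed_closure.
- exact: disk_convex.
- by move=> k k1 x; exact: diskZ1.
- move=> x; have [k k0 Dk] := aD x; exists `|k|^-1; first by rewrite invr_gt0 normr_gt0.
  move=> l kl; have l0 : l != 0.
    by rewrite -normr_gt0; apply: lt_le_trans kl; rewrite invr_gt0 normr_gt0.
  exists (l^-1 *: x); last by rewrite scalerA divff// scale1r.
  apply: subset_closure; apply: diskZ Dk => //.
  by rewrite normfV -[leRHS]invrK lef_pV2 ?posrE ?invr_gt0 ?normr_gt0.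
Qed.

End Functionals.

Section FunctionalSeparation.
Context (R : realType) (K : numFieldType) (KRC : real_or_complex R K).
Context (E : tvsType K).

Lemma kolmogorov_functional (x : E) : kolmogorov_space E -> x != 0 ->
  exists2 h : {linear E -> K^o}, continuous h & h x <> 0.
Proof.
move=> /kolmogorov_nbhs0 T0 x0; pose D := [set (0 : E)].
have dD : disk D by split => // a b _ _ _ -> ->; rewrite /D/= !scaler0 addr0.
have [|h ch [_ hx]] := hahn_banach_tvs KRC (x0 := x) dD.
  move=> /closureP0 Dx; move/eqP: x0; apply; apply: T0 => U U0.
  have [|y Uy] := Dx [set y | U (- y)].
    by have := nbhs0N U0; apply: filterS => _ [y Uy <-] /=; rewrite opprK.
  by rewrite /D/= => /eqP; rewrite addr_eq0 => /eqP ->.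
by exists h => // hx0; move: hx; rewrite hx0 normr0 ltr10.
Qed.

End FunctionalSeparation.

Section PtakOpenMapping.
Context (R : realType) (K : numFieldType) (KRC : real_or_complex R K).
Context (E F : tvsType K) (u : {linear E -> F}).

(* The range of the transpose of [u], without extending functionals from the
   range of [u] to [F]. *)
Definition transpose_range : set (dual E) := [set f | exists2 V : set F, nbhs 0 V &
  exists2 M : K, 0 < M & forall x, V (u x) -> `|dual_fun f x| <= M].

Lemma transpose_range_linear : linear_set transpose_range.
Proof.
split.
  by exists setT; [exact: filterT|exists 1 => // x _; rewrite dual_fun0 normr0].
move=> k f g [V V0 [M M0 fM]] [W W0 [N N0 gN]].
exists (V `&` W); first exact: filterI.
exists (`|k| * M + N); first by rewrite ltr_wpDl// mulr_ge0// ltW.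
move=> x [Vx Wx]; rewrite dual_funD dual_funZ; apply: le_trans (ler_normD _ _) _.
by rewrite normrM lerD ?gN// ler_wpM2l// fM.
Qed.

(** The value [f x] depends continuously on [u x], so approximating [u x] by [u y] with [y] in [U]
    carries the bound on [U] over to [x]. *)
Lemma transpose_range_closure (f : dual E) (U : set E) x : transpose_range f ->
  (forall y, U y -> `|dual_fun f y| <= 1) -> closure (u @` U) (u x) -> `|dual_fun f x| <= 1.
Proof.
move=> [V V0 [M M0 fM]] fU ux; apply/ler_addgt0Pr => e e0.
(* If [(M / e) *: u (x - y)] is in [V], then [|f (x - y)| <= e]. *)
have Me : M / e != 0 by rewrite mulf_neq0 ?invr_neq0 ?gt_eqF.
have [_ [v [[y Uy <-] Vv uxE]]] := closureD_sub (nbhs0_scale Me V0) ux.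
have := fM ((M / e) *: (x - y)).
rewrite linearZ linearB uxE addrAC subrr add0r => /(_ Vv).
rewrite linearZ_LR linearB normrM gtr0_norm ?divr_gt0//.
rewrite mulrAC ler_pdivrMr// ler_pM2l// => fxy.
rewrite -[dual_fun f x](subrK (dual_fun f y)) addrC.
by apply: le_trans (ler_normD _ _) _; apply: lerD => //; exact: fU.
Qed.

(** Near openness gives one [V] for all members of the polar of [U]. At each [x] the bound 2 is 1
    for the approximating [f] plus 1 for its distance to [g]; [f] may depend on [x], but [V] does
    not. *)
Lemma transpose_range_almost_closed : nearly_open u -> almost_closed transpose_range.
Proof.
move=> /nearly_openP nu U g U0 gU gQ; have [V V0 VU] := nu U U0.
exists V => //; exists 2 => // x Vx.
have [f [Qf fU] /(_ x)] := gQ [:: x] 1 ltr01; rewrite inE eqxx => /(_ isT) fg.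
rewrite -[dual_fun g x](subrK (dual_fun f x)); apply: le_trans (ler_normD _ _) _.
rewrite -[2]/(1 + 1); apply: lerD; first by rewrite distrC ltW.
by apply: transpose_range_closure Qf fU _; exact: VU.
Qed.

Lemma ptak_open : ptak E -> kolmogorov_space F -> injective u -> continuous u ->
  nearly_open u -> open_at0 u.
Proof.
move=> /ptakP pE T0 iu cu nu U /nbhs0_closed_disk[C [C0 dC cC CU]].
(* The pullbacks of functionals on the T0 space [F] separate points, as [u] is injective, so the
   transpose range is the whole dual. *)
have QT f : transpose_range f.
  apply: (pE _ transpose_range_linear (transpose_range_almost_closed nu) f) => y Qy.
  have [->|y0] := eqVneq y 0; first by rewrite linear0.
  have [|h ch hy] := kolmogorov_functional KRC (x := u y) T0.
    by apply: contra_neq y0 => uy; apply: iu; rewrite uy linear0.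
  exfalso; apply: hy.
  pose hu : {linear E -> K^o} := h \o u.
  have chu : continuous hu by move=> x; apply: continuous_comp; [exact: cu|exact: ch].
  apply: (Qy (mk_dual chu)); exists [set z | `|h z| <= 1].
    exact: continuous_functional_nbhs0.
  by exists 1.
(* Now every functional on [E] keeps its bound on [C] when passing to the closure of the image, so a
   point [x] with [u x] in [V] cannot be separated from the closed disk [C]. *)
have [V V0 VC] := (nearly_openP u).1 nu C C0.
exists V => // x Vx; exists x => //; apply: CU; apply: contrapT => nCx.
have [|h ch [hC hx]] := hahn_banach_tvs KRC (x0 := x) dC; first by move/cC.
have := transpose_range_closure (QT (mk_dual ch)) hC (VC x Vx).
by rewrite mk_dualE (lt_geF hx).
Qed.

End PtakOpenMapping.

Section OpenImage.
Context (K : numFieldType) (E G : tvsType K) (w : {linear E -> G}).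
Hypotheses (w_surj : forall y, exists x, w x = y) (w_cont : continuous w).
Hypothesis w_open : open_at0 w.

Lemma open_image_nbhs0 U : nbhs 0 U -> nbhs 0 (w @` U).
Proof.
move=> /w_open[V V0 VU]; apply: filterS V0 => y; have [x <-] := w_surj y.
by move=> /VU[z Uz <-]; exists z.
Qed.

Lemma barreled_image : barreled E -> barreled G.
Proof.
move=> bE B [cB convB circB absB].
have /bE/open_image_nbhs0 : barrel (w @^-1` B).
  split.
  - exact: closed_comp.
  - move=> x y l; rewrite !inE /preimage/= => Bx By.
    have := convB (w x) (w y) l; rewrite !inE => /(_ Bx By).
    by rewrite !conv_lmodE linearD !linearZ.
  - by move=> k k1 x Bx; rewrite /preimage/= linearZ; exact: circB.
  - move=> x; have [r r0 rB] := absB (w x); exists r => // k rk.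
    have [b Bb wx] := rB k rk.
    have k0 : k != 0 by rewrite -normr_gt0; exact: lt_le_trans rk.
    exists (k^-1 *: x); last by rewrite scalerA divff// scale1r.
    by rewrite /preimage/= linearZ/= wx scalerA mulVf// scale1r.
by apply: filterS => _ [x Bx <-].
Qed.

(** [Q] is pulled back along [w] to a set [P] of functionals on [E]. Limits of members of [P] still
    vanish on the kernel of [w], hence descend to [G], where openness of [w] makes them
    continuous. *)
Lemma ptak_image : ptak E -> ptak G.
Proof.
move=> /ptakP pE; apply/ptakP => Q linQ acQ g gQ.
have wc (f : dual G) : continuous (dual_fun f \o w).
  by move=> x; apply: continuous_comp; [exact: w_cont|exact: dual_fun_continuous].
pose tr (f : dual G) : dual E := mk_dual (h := (dual_fun f \o w : {linear E -> K^o})) (wc f).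
pose P := [set h | exists2 f, Q f & h = tr f].
have linP : linear_set P.
  split; first by exists 0; [exact: linQ.1|exact: dual_eq].
  move=> k _ _ [f1 Q1 ->] [f2 Q2 ->]; exists (k *: f1 + f2); first exact: linQ.2.
  exact: dual_eq.
have acP : almost_closed P.
  move=> U h U0 hU hP.
  have hw x : w x = 0 -> dual_fun h x = 0.
    move=> wx; apply/eqP/negP => /negP hx.
    have [|_ [[f Qf ->] _]] := hP [:: x] `|dual_fun h x|; first by rewrite normr_gt0.
    move=> /(_ x); rewrite inE eqxx => /(_ isT).
    by rewrite mk_dualE/= wx linear0 sub0r normrN ltxx.
  have [s sK] := choice w_surj.
  have hs x : dual_fun h (s (w x)) = dual_fun h x.
    by apply: subr0_eq; rewrite -linearB; apply: hw; rewrite linearB/= sK subrr.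
  have hsl : linear (fun y => dual_fun h (s y) : K^o).
    by move=> k y z; rewrite -linearP -[RHS]hs linearP/= !sK.
  pose k : {linear G -> K^o} := HB.pack (fun y => dual_fun h (s y) : K^o)
    (GRing.isLinear.Build K G K^o *:%R (fun y => dual_fun h (s y) : K^o) hsl).
  have kU y : (w @` U) y -> `|k y| <= 1.
    by move=> [x Ux <-]; rewrite /k/= hs; exact: hU.
  have ck : continuous k := functional_continuous (open_image_nbhs0 U0) ltr01 kU.
  exists (mk_dual ck); last by apply: dual_eq; apply/funext => x; rewrite [RHS]hs.
  apply: (acQ (w @` U)) => //; first exact: open_image_nbhs0.
  move=> t e e0; have [_ [[f Qf ->] fU] fh] := hP [seq s y | y <- t] e e0.
  exists f; first by split => // _ [x Ux <-]; exact: fU.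
  by move=> y /(map_f s)/fh; rewrite -[dual_fun (tr f) _]/(dual_fun f (w (s y))) sK.
have [f Qf fg] : P (tr g).
  apply: (pE P) => // y Py; apply: gQ => f Qf; apply: (Py (tr f)).
  by exists f.
suff -> : g = f by [].
apply: dual_eq; apply/funext => y; have [x <-] := w_surj y.
by have := congr1 (fun h => dual_fun h x) fg.
Qed.

End OpenImage.

Section ClosedGraph.
Context (R : realType) (K : numFieldType) (KRC : real_or_complex R K).
Context (E F : tvsType K) (u : {linear E -> F}).

Definition transpose_domain : set (dual F) := [set g | continuous (dual_fun g \o u)].

Lemma transpose_domain_linear : linear_set transpose_domain.
Proof.
split; first by move=> x; exact: cvg_cst.
move=> k f g cf cg x; apply: (@cvgD _ K^o _ (nbhs x) _ (fun y => k *: dual_fun f (u y))).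
  by apply: cvgZr; exact: cf.
exact: cg.
Qed.

(** The closure of the preimage of a disk neighborhood is a barrel, hence a neighborhood. For [f] in
    the domain, [f \o u] is continuous and keeps its bound 1 on this closure; [g \o u] is within 1
    of such an [f] at each point. *)
Lemma transpose_domain_almost_closed : barreled E -> almost_closed transpose_domain.
Proof.
move=> bE U g U0 gU gQ; have [D [D0 dD DU]] := nbhs0_disk U0.
have N0 : nbhs 0 (closure (u @^-1` D)).
  apply: bE; apply: disk_closure_barrel; first exact: disk_preimage.
  by move=> x; have [k k0 Dk] := nbhs0_absorb D0 (u x); exists k; rewrite // /preimage/= linearZ.
pose gu : {linear E -> K^o} := dual_fun g \o u.
apply: (functional_continuous (h := gu) N0 (M := 2)) => // x Nx.
have [f [Qf fU] /(_ (u x))] := gQ [:: u x] 1 ltr01; rewrite inE eqxx => /(_ isT) fg.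
rewrite -[gu x](subrK (dual_fun f (u x))); apply: le_trans (ler_normD _ _) _.
rewrite -[2]/(1 + 1); apply: lerD; first by rewrite distrC ltW.
apply: (functional_closure_le1 (h := (dual_fun f \o u : {linear E -> K^o})) Qf _ Nx).
by move=> y Dy; apply: fU; exact: DU.
Qed.

(** If [y != 0], the point [(0, y)] is off the closed graph and is separated from it by some [h],
    which is bounded on the graph, hence zero there. Its components satisfy [h2 \o u = - h1], so
    [h2] is in the domain of the transpose, with a nonzero value at [y]. *)
Lemma transpose_domain_separating (y : F) : closed_map u ->
  (forall g, transpose_domain g -> dual_fun g y = 0) -> y = 0.
Proof.
move=> cu gy; apply/eqP/negP => /negP y0; pose D := [set p : E * F | p.2 = u p.1].
have dD : disk D.
  split; first by rewrite /D/= linear0.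
  by move=> a b p q _; rewrite /D/= => -> ->; rewrite linearP linearZ.
have [|h ch [hD hy]] := hahn_banach_tvs KRC (x0 := (0, y)) dD.
  by move=> /cu; rewrite /=linear0 => yE; rewrite yE eqxx in y0.
have hu x : h (x, u x) = 0.
  by apply: functional_eq0 => k; apply: hD; rewrite /D/= linearZ.
have [[A B] /= [A0 B0] AB] := continuous_functional_nbhs0 ch ltr01.
have hlin1 : linear (fun x => h (x, 0) : K^o).
  move=> k x z; rewrite -[RHS]linearP; congr (h (_, _)).
  by rewrite /= scaler0 addr0.
have hlin2 : linear (fun z => h (0, z) : K^o).
  move=> k x z; rewrite -[RHS]linearP; congr (h (_, _)).
  by rewrite /= scaler0 addr0.
pose h1 : {linear E -> K^o} := HB.pack (fun x => h (x, 0) : K^o)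
  (GRing.isLinear.Build K E K^o *:%R (fun x => h (x, 0) : K^o) hlin1).
pose h2 : {linear F -> K^o} := HB.pack (fun x => h (0, x) : K^o)
  (GRing.isLinear.Build K F K^o *:%R (fun x => h (0, x) : K^o) hlin2).
have c1 : continuous h1.
  apply: (functional_continuous (M := 1) A0) => // x Ax.
  by apply: AB; split => //=; exact: nbhs_singleton.
have c2 : continuous h2.
  apply: (functional_continuous (M := 1) B0) => // x Bx.
  by apply: AB; split => //=; exact: nbhs_singleton.
have := gy (mk_dual c2); rewrite mk_dualE /= => hy0.
suff : h (0, y) = 0 by move=> h0; move: hy; rewrite h0 normr0 ltr10.
apply: hy0; rewrite /transpose_domain/=.
have -> : dual_fun (mk_dual c2) \o u = (fun x => - h1 x).
  apply/funext => x; have xE : (x, u x) = (x, 0) + (0, u x) :> E * F.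
    by congr (_, _); rewrite /= ?addr0 ?add0r.
  by have /eqP := hu x; rewrite xE linearD addrC addr_eq0 => /eqP.
by move=> x; apply: cvgN; exact: c1.
Qed.

Lemma closed_graph : barreled E -> ptak F -> closed_map u -> continuous u.
Proof.
move=> bE /ptakP pF cu.
have QT g : transpose_domain g.
  apply: (pF _ transpose_domain_linear (transpose_domain_almost_closed bE) g) => y.
  by move/(transpose_domain_separating cu) => ->; rewrite linear0.
apply/linear_continuous0 => V /nbhs0_closed_disk[C [C0 dC cC CV]].
have : nbhs 0 (closure (u @^-1` C)).
  apply: bE; apply: disk_closure_barrel; first exact: disk_preimage.
  by move=> x; have [k k0 Ck] := nbhs0_absorb C0 (u x); exists k; rewrite // /preimage/= linearZ.
apply: filterS => x Cx; apply: CV; apply: contrapT => nCx.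
have [|h ch [hC hx]] := hahn_banach_tvs KRC (x0 := u x) dC; first by move/cC.
have := functional_closure_le1 (h := (h \o u : {linear E -> K^o})) (QT (mk_dual ch)) _ Cx.
by rewrite (lt_geF hx) => H; suff : false by []; apply: H => y; exact: hC.
Qed.

End ClosedGraph.

(** * Banach spaces *)

Section Banach.
Context (R : realType) (K : numFieldType) (KRC : real_or_complex R K).
Context (E : completeNormedModType K).

Lemma norm_nbhs0 (U : set E) : nbhs 0 U <->
  exists2 e : K, 0 < e & forall x, `|x| < e -> U x.
Proof.
split=> [/nbhs_ballP[e e0 eU]|[e e0 eU]].
  by exists e => // x xe; apply: eU; rewrite -ball_normE/= sub0r normrN.
by apply/nbhs_ballP; exists e => // x; rewrite -ball_normE/= sub0r normrN; exact: eU.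
Qed.

Lemma geometric_cvg (x : nat -> E) (r : nat -> K) :
  (forall n, 0 < r n) -> (forall n, r n.+1 <= r n / 2) ->
  (forall n, `|x n.+1 - x n| <= r n) -> exists l, forall n, `|l - x n| <= 2 * r n.
Proof.
move=> r0 rS xS.
(* The subtracted term makes the telescoping bound inductive; each halving of the radii pays for one
   more step. *)
have xB n m : `|x (n + m)%N - x n| <= 2 * r n - 2 * r (n + m)%N.
  elim: m => [|m IH]; first by rewrite addn0 !subrr normr0.
  rewrite addnS -[x _](subrK (x (n + m)%N)) -addrA.
  apply: le_trans (ler_normD _ _) _; apply: le_trans (lerD (xS _) IH) _.
  have -> : r (n + m)%N + (2 * r n - 2 * r (n + m)%N) = 2 * r n - r (n + m)%N by ring.
  by rewrite lerD2l lerN2 mulrC -ler_pdivlMr.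
have rB n : r n <= r 0%N * 2^-1 ^+ n.
  elim: n => [|n IH]; first by rewrite expr0 mulr1.
  by apply: le_trans (rS n) _; rewrite exprSr mulrA ler_pM2r// invr_gt0.
have r_small e : 0 < e -> exists n, 2 * r n < e.
  move=> e0; have e1 : 0 < e / (2 * r 0%N) by rewrite divr_gt0// mulr_gt0.
  have [n ne] := scalar_exp2V_small KRC e1; exists n.
  apply: le_lt_trans (_ : 2 * (r 0%N * 2^-1 ^+ n) < e); first by rewrite ler_pM2l.
  by rewrite mulrA -ltr_pdivlMl ?mulr_gt0// mulrC.
have x2B n m : (n <= m)%N -> `|x m - x n| <= 2 * r n.
  move=> /subnKC <-; apply: le_trans (xB _ _) _.
  by rewrite gerBl mulr_ge0// ltW.
have : cvg (x @ \oo).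
  apply: cauchy_cvg; apply: cauchy_exP => e e0; have [n ne] := r_small e e0.
  exists (x n); exists n => // m /= nm; rewrite -ball_normE/= distrC.
  exact: le_lt_trans (x2B _ _ nm) ne.
move=> /cvg_ex[l xl]; exists l => n; apply/ler_addgt0Pr => e e0.
have /xl[k _ kl] : nbhs l [set y | `|l - y| < e] by apply/nbhs_ballP; exists e => // y; rewrite -ball_normE.
have /= lk := kl (maxn n k) (leq_maxr _ _).
rewrite -[l](subrK (x (maxn n k))) -addrA addrC; apply: le_trans (ler_normD _ _) _.
by rewrite lerD ?x2B ?leq_maxl// ltW.
Qed.

(** A Baire argument: if [B] is not a neighborhood of 0, no multiple of it contains a ball.
    Shrinking balls avoid the multiples [2 ^ n B] in turn, and their limit contradicts
    absorption. *)
Lemma banach_barreled : barreled E.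
Proof.
move=> B [cB convB circB absB]; apply: contrapT => nB.
have B0 : B 0.
  have [r r0 rB] := absB 0; have [|b Bb] := rB r; first by rewrite ger0_norm// ltW.
  by move=> /esym/eqP; rewrite scaler_eq0 gt_eqF//= => /eqP <-.
have dB : disk B := convex_circled_disk B0 convB circB.
pose c n : K := 2^-1 ^+ n; have c0 n : 0 < c n by rewrite exprn_gt0 ?invr_gt0.
(* A triple holds a stage, a center and a radius. When the radius is not positive, the pair is
   returned unchanged only to make the choice total. *)
have step (p : nat * (E * K)) : exists q : E * K, 0 < p.2.2 ->
    [/\ 0 < q.2, q.2 <= p.2.2 / 2, `|q.1 - p.2.1| <= p.2.2 &
     forall y, `|y - q.1| <= 2 * q.2 -> ~ B (c p.1 *: y)].
  case: p => n [x r] /=; have [r0|nr0] := pselect (0 < r); last by exists (x, r).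
  have [x' xx' nBx'] : exists2 x', `|x' - x| < r & ~ B (c n *: x').
    (* If a ball around [x] lay in [2 ^ n B], then [z], as the midpoint of [c n *: x + z] and
       [- (c n *: x - z)], would be in [B] for all small [z]. *)
    apply: contrapT => nx; apply: nB; apply/norm_nbhs0; exists (c n * r); first exact: mulr_gt0.
    have Bx z : `|z| < c n * r -> B (c n *: x + z).
      move=> zr; apply: contrapT => nBz; apply: nx; exists (x + (c n)^-1 *: z).
        by rewrite addrAC subrr add0r normrZ gtr0_norm ?invr_gt0// ltr_pdivrMl.
      by rewrite scalerDr scalerA divff ?gt_eqF// scale1r.
    move=> z zr; have -> : z = 2^-1 *: (c n *: x + z) + 2^-1 *: (- (c n *: x - z)).
      rewrite -scalerDr opprB [c n *: x + z]addrC addrACA subrr addr0 scalerDr -scalerDl.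
      by rewrite -[X in X + X]div1r -splitr scale1r.
    by apply: disk_half => //; [exact: Bx|apply: diskN => //; apply: Bx; rewrite normrN].
  have cB' : closed [set y | B (c n *: y)].
    by apply: (closed_comp (f := fun y => c n *: y)) => // y _; exact: scaler_continuous.
  have /nbhs_ballP[e /= e0 eB] : nbhs x' (~` [set y | B (c n *: y)]).
    by apply: open_nbhs_nbhs; split => //; exact: closed_openC.
  have e30 : 0 < e / 3 by rewrite divr_gt0.
  have r20 : 0 < r / 2 by rewrite divr_gt0.
  have [d [d0 de dr]] := pos_lower_bound e30 r20.
  exists (x', d) => _; split => //=; first exact: ltW.
  move=> y yd; apply: eB; rewrite -ball_normE/= distrC; apply: le_lt_trans yd _.
  apply: le_lt_trans (_ : 2 * (e / 3) < e); first by rewrite ler_pM2l.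
  by rewrite mulrCA gtr_pMr// ltr_pdivrMr// mul1r ltr_nat.
have [f fP] := choice step.
pose a := fix a n := if n is m.+1 then f (m, a m) else (0, 1) : E * K.
have a0 n : 0 < (a n).2 by elim: n => [|n IH] //=; have [] := fP (n, a n) IH.
have [|||l al] := @geometric_cvg (fun n => (a n).1) (fun n => (a n).2).
- exact: a0.
- by move=> n; have [] := fP (n, a n) (a0 n).
- by move=> n; have [] := fP (n, a n) (a0 n).
have [r r0 rB] := absB l.
have rV0 : 0 < r^-1 by rewrite invr_gt0.
have [n nr] := scalar_exp2V_small KRC rV0.
(* The ball avoiding [2 ^ n B] is the one centered at term [n.+1], and the limit is within twice its
   radius. *)
have [_ _ _ /(_ l (al n.+1))] := fP (n, a n) (a0 n); apply => /=.
have [|b Bb ->] := rB (c n)^-1.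
  by rewrite gtr0_norm ?invr_gt0// -[leLHS]invrK lef_pV2 ?posrE// ltW.
by rewrite scalerA divff ?scale1r// gt_eqF.
Qed.

(** Successive approximation: near openness lets a vector of norm less than [r n] bring the residual
    [v (x - s n)] into the next neighborhood. The radii [e / 3 * 2 ^- n] keep the limit within
    [2 * (e / 3) < e] of 0. *)
Lemma banach_open (F : tvsType K) (v : {linear E -> F}) :
  kolmogorov_space F -> continuous v -> nearly_open v -> open_at0 v.
Proof.
move=> /kolmogorov_nbhs0 T0 cv /nearly_openP nv U /norm_nbhs0[e e0 eU].
have /choice[V VP] : forall r : K, exists V : set F, 0 < r ->
    nbhs 0 V /\ forall x, V (v x) -> closure (v @` [set x | `|x| < r]) (v x).
  move=> r; have [r0|] := pselect (0 < r); last by exists setT.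
  have [|V V0 Vr] := nv [set x | `|x| < r]; first by apply/norm_nbhs0; exists r.
  by exists V.
pose r n : K := e / 3 * 2^-1 ^+ n.
have r0 n : 0 < r n by rewrite mulr_gt0 ?divr_gt0// exprn_gt0 ?invr_gt0.
exists (V (r 0%N)); first by have [] := VP _ (r0 0%N).
move=> x Vx.
have step (p : nat * E) : exists s : E, V (r p.1) (v (x - p.2)) ->
    `|s - p.2| <= r p.1 /\ V (r p.1.+1) (v (x - s)).
  case: p => n s /=; have [Vs|nVs] := pselect (V (r n) (v (x - s))); last by exists s.
  have cl := (VP _ (r0 n)).2 _ Vs.
  have [_ [w [[d /= dr <-] Vw vw]]] := closureD_sub (VP _ (r0 n.+1)).1 cl.
  exists (s + d) => _; rewrite addrAC subrr add0r ltW//; split => //.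
  by rewrite opprD addrA linearB/= vw addrAC subrr add0r.
have [f fP] := choice step.
pose s := fix s n := if n is m.+1 then f (m, s m) else 0 : E.
have sV n : V (r n) (v (x - s n)).
  by elim: n => [|n IH]; [rewrite subr0|have [] := fP (n, s n) IH].
have [|||l sl] := @geometric_cvg s r.
- exact: r0.
- by move=> n; rewrite /r exprSr mulrA.
- by move=> n; have [] := fP (n, s n) (sV n).
exists l.
  apply: eU; rewrite -[l]subr0; apply: le_lt_trans (sl 0%N) _.
  by rewrite /r expr0 mulr1 mulrCA gtr_pMr// ltr_pdivrMr// mul1r ltr_nat.
(* The residual [v (x - s n)] is only known to lie in the closure of the image of a small ball; a
   closed disk [C] catches it, and continuity of [v] handles [v (s n - l)]. *)
apply/esym/subr0_eq/T0 => W /nbhs0_add[W' W'0 W'W].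
have [C [C0 dC cC CW]] := nbhs0_closed_disk W'0.
have /norm_nbhs0[d d0 dC'] := (linear_continuous0 v).1 cv C C0.
have [n nd] : exists n, 2 * r n < d.
  have d1 : 0 < d / (2 * (e / 3)) by rewrite divr_gt0// mulr_gt0// divr_gt0.
  have [n nd] := scalar_exp2V_small KRC d1; exists n.
  by rewrite /r mulrA -ltr_pdivlMl ?mulr_gt0 ?divr_gt0// mulrC.
have -> : v x - v l = v (x - s n) + v (s n - l).
  by rewrite -linearB -linearD addrA subrK.
apply: W'W; apply: CW.
  rewrite (closure_id C).1//; apply: closureS ((VP _ (r0 n)).2 _ (sV n)).
  move=> _ [y /= yr <-]; apply: dC'; apply: lt_trans yr _; apply: lt_trans nd.
  by rewrite ltr_pMl// ltr1n.
by apply: dC'; rewrite distrC; apply: le_lt_trans (sl n) nd.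
Qed.

(** Composing with the quotient map moves the open mapping argument from [E / A] to [E], where
    completeness is available. *)
Lemma banach_ptak : ptak E.
Proof.
apply: (ptak_of_open KRC) => A F u cA T0 iu cu nu.
pose v : {linear E -> F} := u \o quot_map A.
have cv : continuous v.
  by move=> x; apply: continuous_comp; [exact: quot_map_continuous|exact: cu].
have nv : nearly_open v.
  apply/nearly_openP => N N0.
  have [V V0 VN] := (nearly_openP u).1 nu _ (quot_map_nbhs0 A N0).
  by exists V => // x /VN; rewrite image_comp.
move=> U U0; have cq := linear_continuous0 (quot_map A).
have [|V V0 VU] := banach_open T0 cv nv (U := quot_map A @^-1` U).
  by apply: cq.1 => //; exact: quot_map_continuous.
exists V => // y; have [x <-] := quot_map_surj y => /VU[z Uz zx].
by exists (quot_map A z).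
Qed.

End Banach.

(** * Bounded functions *)

Section BoundedFunctions.
Context (K : numFieldType) (X : Type).

Definition bounded_pred : {pred X -> K^o} :=
  [pred f | `[< exists M : K, forall x, `|f x| <= M >]].

Fact bounded_submod_closed : submod_closed bounded_pred.
Proof.
split; first by apply/asboolP; exists 0 => x; rewrite normr0.
move=> k f g /asboolP[M fM] /asboolP[N gN]; apply/asboolP.
exists (`|k| * M + N) => x; apply: le_trans (ler_normD _ _) _.
by rewrite normrM lerD// ler_wpM2l.
Qed.

HB.instance Definition _ := GRing.isSubmodClosed.Build K (X -> K^o) bounded_pred
  bounded_submod_closed.

End BoundedFunctions.

(* The proof that [K] is the field of real or complex numbers is a parameter of
   the type, so that the norm and the completeness are inferred from it. *)
Definition linf (R : realType) (K : numFieldType) (KRC : real_or_complex R K)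
  (X : Type) : Type := {f : X -> K^o | f \in @bounded_pred K X}.

Section Linf.
Context (R : realType) (K : numFieldType) (KRC : real_or_complex R K) (X : Type).

Local Notation L := (linf KRC X).

HB.instance Definition _ := SubChoice.on L.
HB.instance Definition _ := [SubChoice_isSubLmodule of L by <:].

Definition linf_fun (f : L) : X -> K^o := val f.

Lemma linf_bounded (f : L) : exists M : K, forall x, `|linf_fun f x| <= M.
Proof. exact: asboolW (valP f). Qed.

Definition linf_is_norm (f : L) (s : K) : Prop :=
  [/\ 0 <= s, forall x, `|linf_fun f x| <= s &
   forall t : K, 0 <= t -> (forall x, `|linf_fun f x| <= t) -> s <= t].

Lemma linf_norm_exists f : exists s, linf_is_norm f s.
Proof.
have [M fM] := linf_bounded f.
(* Including 0 keeps the set nonempty when [X] is empty. *)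
pose A := [set a : K | a = 0 \/ exists x, a = `|linf_fun f x|].
have [||s [As sA]] := @scalar_sup R K KRC A `|M|.
- by exists 0; left.
- move=> _ [->|[x ->]]; first by rewrite lexx normr_ge0.
  by rewrite normr_ge0 (le_trans (fM x))// real_ler_norm// ger0_real// (le_trans _ (fM x)).
exists s; split.
- by apply: As; left.
- by move=> x; apply: As; right; exists x.
- by move=> t t0 ft; apply: sA => _ [->|[x ->]].
Qed.

Definition linf_norm (f : L) : K := sval (cid (linf_norm_exists f)).

Lemma linf_normP f : linf_is_norm f (linf_norm f).
Proof. exact: svalP (cid (linf_norm_exists f)). Qed.

Lemma linf_norm_ge0 f : 0 <= linf_norm f. Proof. by have [] := linf_normP f. Qed.

Lemma linf_norm_ge f x : `|linf_fun f x| <= linf_norm f.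
Proof. by have [_ + _] := linf_normP f; apply. Qed.

Lemma linf_norm_le f (t : K) : 0 <= t -> (forall x, `|linf_fun f x| <= t) -> linf_norm f <= t.
Proof. by have [_ _ +] := linf_normP f; apply. Qed.

Fact linf_ler_normD f g : linf_norm (f + g) <= linf_norm f + linf_norm g.
Proof.
apply: linf_norm_le => [|x]; first by rewrite addr_ge0 ?linf_norm_ge0.
by apply: le_trans (ler_normD _ _) _; rewrite lerD ?linf_norm_ge.
Qed.

Fact linf_normZ_le (k : K) f : linf_norm (k *: f) <= `|k| * linf_norm f.
Proof.
apply: linf_norm_le => [|x]; first by rewrite mulr_ge0 ?linf_norm_ge0.
by rewrite [X in `|X|](_ : _ = k * linf_fun f x)// normrM ler_wpM2l ?linf_norm_ge.
Qed.

Fact linf_normZ (k : K) f : linf_norm (k *: f) = `|k| * linf_norm f.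
Proof.
apply/eqP; rewrite eq_le linf_normZ_le/=; have [->|k0] := eqVneq k 0.
  by rewrite normr0 mul0r linf_norm_ge0.
rewrite -ler_pdivlMl ?normr_gt0// -normfV.
by apply: le_trans (linf_normZ_le _ _); rewrite scalerA mulVf// scale1r.
Qed.

Fact linf_norm0_eq0 f : linf_norm f = 0 -> f = 0.
Proof.
move=> f0; apply: val_inj; apply/funext => x; apply/eqP; rewrite -normr_le0.
by have := linf_norm_ge f x; rewrite f0.
Qed.

HB.instance Definition _ := Lmodule_isNormed.Build K L
  linf_ler_normD linf_normZ linf_norm0_eq0.

Lemma linf_fun_le (f : L) x : `|linf_fun f x| <= `|f|.
Proof. exact: linf_norm_ge. Qed.

Lemma linf_normr_le (f : L) (t : K) :
  0 <= t -> (forall x, `|linf_fun f x| <= t) -> `|f| <= t.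
Proof. exact: linf_norm_le. Qed.

Fact linf_complete (F : set_system L) : ProperFilter F -> cauchy F -> cvg F.
Proof.
move=> FF /cauchyP cF.
have cF' (e : K) : 0 < e -> exists f, F [set g : L | `|f - g| < e].
  by move=> /cF[f Ff]; exists f; move: Ff; rewrite -ball_normE.
have /choice[l lF] : forall x, exists l : K, forall e : K, 0 < e ->
    F [set g : L | `|l - linf_fun g x| < e].
  move=> x.
  have [|l Fl] := @scalar_cauchy_cvg R K KRC ((fun g : L => linf_fun g x : K) @ F) _.
    move=> e /cF'[f Ff]; exists (linf_fun f x).
    change (F [set g : L | `|linf_fun f x - linf_fun g x| < e]).
    by apply: filterS Ff => g; apply: le_lt_trans; exact: linf_fun_le (f - g) x.
  by exists l.
(* Uniformity in [x]: the comparison function [g] may depend on [x] and [d], but the bound on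
   [|f - g|] does not. *)
have lB (e : K) f : 0 < e -> F [set g : L | `|f - g| < e] -> forall x, `|l x - linf_fun f x| <= e.
  move=> e0 Ff x; apply/ler_addgt0Pr => d d0.
  have [g [/= fg lg]] := filter_ex (filterI Ff (lF x d d0)).
  rewrite -[l x](subrK (linf_fun g x)) -addrA addrC.
  apply: le_trans (ler_normD _ _) _; rewrite lerD ?(ltW lg)//.
  rewrite distrC; apply: le_trans (ltW fg); exact: linf_fun_le (f - g) x.
have lbd : (l : X -> K^o) \in @bounded_pred K X.
  have [f Ff] := cF' 1 ltr01; have [M fM] := linf_bounded f.
  apply/asboolP; exists (1 + M) => x; rewrite -[l x](subrK (linf_fun f x)).
  by apply: le_trans (ler_normD _ _) _; rewrite lerD// (lB 1).
apply/cvg_ex; exists (exist _ (l : X -> K^o) lbd : L) => W /nbhs_ballP[e /= e0 eW].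
have e30 : 0 < e / 3 by rewrite divr_gt0.
have [f Ff] := cF' _ e30; have lf := lB _ _ e30 Ff; apply: filterS Ff => g /= fg; apply: eW.
rewrite -ball_normE/=; apply: (@le_lt_trans _ _ (e / 3 + e / 3)); last first.
  rewrite (_ : e / 3 + e / 3 = e * (2 / 3)); last by ring.
  by rewrite gtr_pMr// ltr_pdivrMr// mul1r ltr_nat.
apply: linf_normr_le => [|x]; first by rewrite addr_ge0// ltW.
rewrite [X in `|X|](_ : _ = (l x - linf_fun f x) + linf_fun (f - g) x); last first.
  by rewrite [linf_fun (f - g) x](_ : _ = linf_fun f x - linf_fun g x)// addrA subrK.
apply: le_trans (ler_normD _ _) _; apply: lerD; first exact: lf.
by apply: le_trans (ltW fg); exact: linf_fun_le.
Qed.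

HB.instance Definition _ := Uniform_isComplete.Build L linf_complete.

End Linf.

(** * Graphs and images *)

Section Separation.
Context (K : numFieldType).
Implicit Types E F : tvsType K.

Lemma kolmogorov_injective E F (u : {linear E -> F}) : injective u -> continuous u ->
  kolmogorov_space F -> kolmogorov_space E.
Proof.
move=> iu /linear_continuous0 cu /kolmogorov_nbhs0 T0; apply/kolmogorov_nbhs0 => x xU.
by apply: iu; rewrite linear0; apply: T0 => U /cu; exact: xU.
Qed.

Lemma kolmogorov_prod E F : kolmogorov_space E -> kolmogorov_space F ->
  kolmogorov_space (E * F)%type.
Proof.
move=> /kolmogorov_nbhs0 TE /kolmogorov_nbhs0 TF; apply/kolmogorov_nbhs0 => -[x y] xyU.
congr (_, _).
  apply: TE => U U0; apply: (xyU (@fst E F @^-1` U)).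
  by apply: (@cvg_fst _ _ (nbhs (0 : E)) (nbhs (0 : F))).
apply: TF => U U0; apply: (xyU (@snd E F @^-1` U)).
by apply: (@cvg_snd _ _ (nbhs (0 : E)) (nbhs (0 : F))).
Qed.

Definition sub_val E (A : submodClosed E) : tvs_sub A -> E := val.

Fact sub_val_linear E (A : submodClosed E) : linear (@sub_val E A).
Proof. by []. Qed.

HB.instance Definition _ E (A : submodClosed E) := GRing.isLinear.Build K (tvs_sub A) E
  *:%R (@sub_val E A) (@sub_val_linear E A).

Lemma kolmogorov_sub E (A : submodClosed E) : kolmogorov_space E ->
  kolmogorov_space (tvs_sub A).
Proof.
apply: (@kolmogorov_injective _ _ (@sub_val E A)); first exact: val_inj.
exact: tvs_sub_val_continuous.
Qed.

Lemma continuous_closed_map E F (u : {linear E -> F}) :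
  kolmogorov_space F -> continuous u -> closed_map u.
Proof.
move=> /kolmogorov_nbhs0 T0 cu [x y] /= xy; apply/esym/subr0_eq/T0 => U U0.
have [W W0 WU] := nbhs0_add U0.
have cV : nbhs x [set z | W (u (x - z))].
  apply/nbhs_shift; have := nbhs0N ((linear_continuous0 u).1 cu W W0).
  by apply: filterS => _ [z Wz <-]; rewrite /= opprD addNKr opprK.
have cW : nbhs y [set z | W (z - y)].
  by apply/nbhs_shift; apply: filterS W0 => z; rewrite /= addrAC subrr add0r.
have /xy[[a b] [/= -> [/= Wa Wb]]] : nbhs (x, y) ([set z | W (u (x - z))] `*` [set z | W (z - y)]).
  by exists ([set z | W (u (x - z))], [set z | W (z - y)]).
have := WU _ _ Wa Wb.
by rewrite linearB addrA subrK.
Qed.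

Lemma closed_map_sym E F (u : E -> F) (v : F -> E) : cancel u v -> cancel v u ->
  closed_map u -> closed_map v.
Proof.
move=> uK vK cu; pose s (p : F * E) : E * F := (p.2, p.1).
rewrite /closed_map; have -> : [set p : F * E | p.2 = v p.1] = s @^-1` [set p : E * F | p.2 = u p.1].
  apply/seteqP; split=> -[y x] /=; first by move=> ->; rewrite vK.
  by move=> ->; rewrite uK.
apply: closed_comp => // -[y x] _; apply: cvg_pair; [exact: cvg_snd|exact: cvg_fst].
Qed.

End Separation.

Section GraphMap.
Context (K : numFieldType) (E F : tvsType K) (u : {linear E -> F}).

Fact graph_map_subproof x : (x, u x) \in graph_pred u.
Proof. by rewrite inE. Qed.

Definition graph_map x : graph_tvs u := exist _ (x, u x) (graph_map_subproof x).

Fact graph_map_linear : linear graph_map.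
Proof. by move=> k x y; apply: val_inj; rewrite /= linearP. Qed.

HB.instance Definition _ := GRing.isLinear.Build K E (graph_tvs u) *:%R graph_map
  graph_map_linear.

Definition graph_fst (z : graph_tvs u) : E := (val z).1.

Fact graph_fst_linear : linear graph_fst.
Proof. by []. Qed.

HB.instance Definition _ := GRing.isLinear.Build K (graph_tvs u) E *:%R graph_fst
  graph_fst_linear.

Lemma graph_mapK : cancel graph_map graph_fst.
Proof. by []. Qed.

Lemma graph_fstK : cancel graph_fst graph_map.
Proof.
by move=> [[x y] xy]; apply: val_inj; have /eqP := xy; exact: (congr2 pair erefl \o esym).
Qed.

Lemma graph_fst_continuous : continuous graph_fst.
Proof.
move=> z; apply: (@continuous_comp _ _ _ (\val : graph_tvs u -> _) fst).
  exact: tvs_sub_val_continuous.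
exact: cvg_fst.
Qed.

Lemma graph_map_continuous : continuous u -> continuous graph_map.
Proof.
move=> cu; apply: tvs_sub_continuous => x.
by apply: cvg_pair; [exact: cvg_id|exact: cu].
Qed.

Lemma graph_map_continuous_inv : continuous graph_map -> continuous u.
Proof.
move=> cg x; apply: (@continuous_comp _ _ _ (\val \o graph_map) (@snd E F)).
  by apply: continuous_comp; [exact: cg|exact: tvs_sub_val_continuous].
exact: cvg_snd.
Qed.

End GraphMap.

Section ImageMap.
Context (K : numFieldType) (E F : tvsType K) (u : {linear E -> F}).

Fact image_map_subproof x : u x \in image_pred u.
Proof. by rewrite !inE; exists x. Qed.

Definition image_map x : image_tvs u := exist _ (u x) (image_map_subproof x).

Fact image_map_linear : linear image_map.
Proof. by move=> k x y; apply: val_inj; rewrite /= linearP. Qed.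

HB.instance Definition _ := GRing.isLinear.Build K E (image_tvs u) *:%R image_map
  image_map_linear.

Lemma image_map_surj y : exists x, image_map x = y.
Proof. by case: y => y yu; have /set_mem[x _ xy] := yu; exists x; apply: val_inj. Qed.

Lemma image_map_continuous : continuous u -> continuous image_map.
Proof. by move=> cu; apply: tvs_sub_continuous. Qed.

Lemma image_map_open : open_at0 u <-> open_at0 image_map.
Proof.
split=> ou U /ou[V V0 VU].
  exists [set z | V (val z)]; last first.
    by move=> x /VU[y Uy yx]; exists y => //; exact: val_inj.
  by apply: (linear_continuous0 (@sub_val _ _ (image_pred u))).1 V0; exact: tvs_sub_val_continuous.
move: V0 => [_ [[W oW <-] /= W0] WV].
exists W; first exact: open_nbhs_nbhs.
by move=> x Wx; have [y Uy yx] := VU x (WV (image_map x) Wx); exists y => //; exact: (congr1 (@sub_val _ _ (image_pred u)) yx).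
Qed.

End ImageMap.

(** * Properties (O), (C) and (G) *)

Section Properties.
Context (K : numFieldType) (C : tvs_class K).
Hypothesis C_T0 : forall E, C E -> kolmogorov_space E.

Lemma open_mapping_continuous_inverse :
  open_mapping_property C -> continuous_inverse_property C.
Proof.
have inv (E F : tvsType K) (u : {linear E -> F}) (v : F -> E) : open_mapping_property C ->
    C E -> C F -> cancel u v -> cancel v u -> continuous u -> continuous v.
  move=> O CE CF uK vK cu; apply/continuousP => W oW.
  have ur : range u = setT by apply/seteqP; split=> // y _; exists (v y).
  have [V oV VE] := O _ _ CE CF u ur cu W oW.
  suff -> : v @^-1` W = V by [].
  move: VE; rewrite ur setIT => <-; apply/seteqP; split=> [y Wy|_ [x Wx <-]].
    by exists (v y).
  by rewrite /preimage/= uK.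
move=> O E F CE CF u v uK vK; split; first exact: inv.
have lv : linear v by move=> k x y; rewrite -[LHS]uK -[RHS]uK linearP !vK.
pose v' : {linear F -> E} := HB.pack v (GRing.isLinear.Build K F E *:%R v lv).
exact: (inv _ _ v').
Qed.

Lemma continuous_inverse_closed_graph : closed_under_closed_graphs C ->
  continuous_inverse_property C -> closed_graph_property C.
Proof.
move=> Cgr CI E F CE CF u; split; last exact: continuous_closed_map (C_T0 CF).
move=> cu; apply: graph_map_continuous_inv.
have [+ _] := CI _ _ (Cgr _ _ CE CF u cu) CE (@graph_fst _ _ _ u) (graph_map u)
  (@graph_fstK _ _ _ u) (@graph_mapK _ _ _ u).
by apply; exact: graph_fst_continuous.
Qed.

Lemma closed_graph_continuous_inverse :
  closed_graph_property C -> continuous_inverse_property C.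
Proof.
have inv (E F : tvsType K) (u : {linear E -> F}) (v : {linear F -> E}) :
    closed_graph_property C -> C E -> C F -> cancel u v -> cancel v u ->
    continuous u -> continuous v.
  by move=> G CE CF uK vK /(G _ _ CE CF) cu; apply/(G _ _ CF CE); exact: closed_map_sym cu.
move=> G E F CE CF u v uK vK.
have lv : linear v by move=> k x y; rewrite -[LHS]uK -[RHS]uK linearP !vK.
pose v' : {linear F -> E} := HB.pack v (GRing.isLinear.Build K F E *:%R v lv).
by split; [exact: (inv _ _ u v')|exact: (inv _ _ v' u)].
Qed.

Lemma continuous_inverse_open_mapping : closed_under_quotients C ->
  continuous_inverse_property C -> open_mapping_property C.
Proof.
move=> Cq CI E F CE CF u ur cu O oO; rewrite ur.
pose N := [set x | u x = 0].
have linN : linear_set N.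
  by split; [exact: linear0|move=> k x y ux uy; rewrite /N/= linearP ux uy scaler0 addr0].
have cN : closed [set` set_pred linN].
  rewrite set_predE => x Nx; apply: (kolmogorov_nbhs0 F).1 (C_T0 CF) _ _ => U U0.
  have /closureP0/(_ _ ((linear_continuous0 u).1 cu _ (nbhs0N U0)))[y [z Uz zy]] := Nx.
  rewrite /N/= linearD -zy => /eqP; rewrite subr_eq0 => /eqP ->.
  exact: Uz.
pose pi := quot_map (set_pred linN).
(* The induced bijection [v] is [u] composed with any section [s] of the quotient map; its inverse
   is the quotient map after any section [t] of [u]. *)
have [s sK] := choice (@quot_map_surj _ _ (set_pred linN)).
have us x : u (s (pi x)) = u x.
  apply: subr0_eq; rewrite -linearB.
  by have /quot_map_eq0/asboolP : pi (s (pi x) - x) = 0 by rewrite /pi linearB/= sK subrr.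
have linus : linear (u \o s).
  move=> k y z; rewrite /= -[y]sK -[z]sK -linearP -/pi/= !us -linearP -us.
  by congr (u (s _)); rewrite linearP !sK.
pose v : {linear tvs_quot (set_pred linN) -> F} :=
  HB.pack (u \o s) (GRing.isLinear.Build K _ F *:%R (u \o s) linus).
have /choice[t tK] : forall y, exists x, u x = y.
  by move=> y; have [x _ <-] : range u y by [rewrite ur]; exists x.
have vK : cancel v (pi \o t).
  move=> y; rewrite -[RHS]sK; apply/eqP; rewrite -subr_eq0 -linearB; apply/eqP.
  by apply/quot_map_eq0/asboolP; rewrite /N/= linearB tK subrr.
have Kv : cancel (pi \o t) v by move=> y; rewrite /= us tK.
have [+ _] := CI _ _ (Cq _ CE _ cN) CF v (pi \o t) vK Kv.
have cv : continuous v.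
  apply/linear_continuous0 => W /((linear_continuous0 u).1 cu) W0.
  apply: filterS (quot_map_nbhs0 (set_pred linN) W0) => _ [x Wx <-].
  by rewrite /preimage/= us.
move=> /(_ cv)/continuousP/(_ _ (@tvs_quot_pi_open _ _ (set_pred linN) _ oO)) oV.
exists ((pi \o t) @^-1` (pi @` O)) => //; rewrite setIT.
apply/seteqP; split=> [_ [x Ox <-]|y [x Ox xt]].
  exists x => //=; apply/eqP; rewrite -subr_eq0 -linearB; apply/eqP.
  by apply/quot_map_eq0/asboolP; rewrite /N/= linearB tK subrr.
by exists x => //; rewrite -(us x) xt us tK.
Qed.

End Properties.

(** * The largest class *)

Section Largest.
Context (R : realType) (K : numFieldType) (KRC : real_or_complex R K).

(** (C) is the hub: it follows from either of the others, and gives (O) through quotients and (G)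
    through graphs. *)
Lemma admissible_properties (C : tvs_class K) : admissible_class C ->
  [/\ open_mapping_property C, continuous_inverse_property C & closed_graph_property C].
Proof.
move=> [T0 [_ Cq Cgr _ OCG]].
have CI : continuous_inverse_property C.
  case: OCG => [|//|]; first exact: open_mapping_continuous_inverse.
  exact: closed_graph_continuous_inverse.
split=> //; first exact: continuous_inverse_open_mapping.
exact: continuous_inverse_closed_graph.
Qed.

Section PolarEvaluation.
Context (E : tvsType K) (B : set E).
Hypothesis B_absorb : absorbing B.

(** Extension by 0 off the polar lets the functions live on all of [dual E]; on the polar they are
    bounded because [B] absorbs [x]. *)
Definition polar_eval (x : E) : dual E -> K^o :=
  fun f => if pselect (polar B f) then dual_fun f x else 0.

Fact polar_eval_bounded x : polar_eval x \in @bounded_pred K (dual E).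
Proof.
have [r r0 /(_ r)[|b Bb ->]] := B_absorb x; first by rewrite ger0_norm// ltW.
apply/asboolP; exists r => f; rewrite /polar_eval; case: pselect => [Bf|_] /=; last first.
  by rewrite normr0 ltW.
by rewrite linearZ_LR normrM gtr0_norm// ler_piMr//; [exact: ltW|exact: Bf].
Qed.

Definition polar_eval_linf (x : E) : linf KRC (dual E) := exist _ (polar_eval x) (polar_eval_bounded x).

Fact polar_eval_linear : linear polar_eval_linf.
Proof.
move=> k x y; apply: val_inj; apply/funext => f.
change (polar_eval (k *: x + y) f = k *: polar_eval x f + polar_eval y f).
rewrite /polar_eval; case: pselect => _ /=; first by rewrite linearP.
by rewrite scaler0 addr0.
Qed.

HB.instance Definition _ := GRing.isLinear.Build K E (linf KRC (dual E)) *:%R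
  polar_eval_linf polar_eval_linear.

(** For each fixed [f], both [polar_eval x f] and the coordinate of a bounded function at [f] are
    continuous, so the graph equation passes to limit points coordinate by coordinate. *)
Lemma polar_eval_closed : closed_map polar_eval_linf.
Proof.
move=> [x g] /= xg; apply/val_inj/funext => f.
apply: subr0_eq; apply/eqP; rewrite -normr_le0; apply/ler_addgt0Pr => e e0; rewrite add0r.
have e20 : 0 < e / 2 by rewrite divr_gt0.
pose U := [set y | `|dual_fun f (y - x)| <= e / 2].
have Ux : nbhs x U.
  apply/nbhs_shift; apply: filterS (continuous_functional_nbhs0 (@dual_fun_continuous _ _ f) e20).
  by move=> y /=; rewrite /U/= addrAC subrr add0r.
pose W := [set h : linf KRC (dual E) | `|g - h| < e / 2].
have Wg : nbhs g W by apply/nbhs_ballP; exists (e / 2) => // h; rewrite -ball_normE.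
have /xg[[y _] [/= -> [/= Uy Wy]]] : nbhs (x, g) (U `*` W) by exists (U, W).
have gy := le_trans (linf_fun_le (g - polar_eval_linf y) f) (ltW Wy).
have yx : `|polar_eval y f - polar_eval x f| <= e / 2.
  rewrite /polar_eval; case: pselect => _ /=; last by rewrite subrr normr0 ltW.
  by rewrite -linearB.
rewrite -[X in X - _](subrK (polar_eval y f)) -addrA [e]splitr.
by apply: le_trans (ler_normD _ _) _; exact: lerD.
Qed.

End PolarEvaluation.

(* Instead of completing [E] for the gauge of a barrel [B], embed it into the
   bounded functions on the polar of [B] by evaluation. *)
Lemma closed_graph_barreled (C : tvs_class K) (E : tvsType K) :
  contains_banach_spaces C -> closed_graph_property C -> C E -> barreled E.
Proof.
move=> CB G CE B [cB convB circB absB].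
have cu : continuous (polar_eval_linf absB).
  have [+ _] := G _ _ CE (CB (linf KRC (dual E))) (polar_eval_linf absB).
  apply; exact: polar_eval_closed.
have B0 : B 0.
  have [r r0 rB] := absB 0; have [|b Bb] := rB r; first by rewrite ger0_norm// ltW.
  by move=> /esym/eqP; rewrite scaler_eq0 gt_eqF//= => /eqP <-.
have dB : disk B := convex_circled_disk B0 convB circB.
have W0 : nbhs (0 : linf KRC (dual E)) [set g : linf KRC (dual E) | `|g| <= 1].
  apply/nbhs_ballP; exists 1 => /= [|g]; first exact: ltr01.
  by rewrite -ball_normE/= sub0r normrN => /ltW.
have := (linear_continuous0 (polar_eval_linf absB)).1 cu _ W0.
apply: filterS => x /= ux; apply: contrapT => nBx.
(* A functional separating [x] from [B] is in the polar, so its coordinate would push the norm of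
   the evaluation at [x] above 1. *)
have [|h ch [hB hx]] := hahn_banach_tvs KRC (x0 := x) dB; first by move/cB.
have := le_trans (linf_fun_le (polar_eval_linf absB x) (mk_dual ch)) ux.
rewrite /linf_fun/= /polar_eval; case: pselect => [_|nh] /=; last by case: nh.
by rewrite mk_dualE (lt_geF hx).
Qed.

Lemma continuous_inverse_ptak (C : tvs_class K) (E : tvsType K) :
  closed_under_quotients C -> closed_under_continuous_images C ->
  continuous_inverse_property C -> C E -> ptak E.
Proof.
move=> Cq Cim CI CE; apply: (ptak_of_open KRC) => A F u cA T0 iu cu nu.
have CA := Cq _ CE A cA; have CF := Cim _ _ CA T0 u iu cu nu.
have [v vK] := choice (@image_map_surj _ _ _ u).
have uK : cancel (image_map u) v.
  move=> x; apply: iu.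
  exact: (congr1 (@sub_val _ _ (image_pred u)) (vK (image_map u x))).
have cv : continuous v.
  by apply: (CI _ _ CA CF (image_map u) v uK vK).1; exact: image_map_continuous.
apply/image_map_open; move=> U U0; exists (v @^-1` U).
  by apply: cv; rewrite -(linear0 (image_map u)) uK.
by move=> x; rewrite /preimage/= uK => Ux; exists x.
Qed.

(** Quotients, closed graphs and continuous images are all treated as open continuous linear images
    of the original space. *)
Lemma barreled_ptak_open_image (E G : tvsType K) (w : {linear E -> G}) :
  (forall y, exists x, w x = y) -> continuous w -> open_at0 w -> kolmogorov_space G ->
  barreled_ptak E -> barreled_ptak G.
Proof.
move=> ws cw ow T0 [_ bE pE]; split=> //; first exact: (barreled_image ws cw ow).
exact: (ptak_image ws cw ow).
Qed.

Lemma barreled_ptak_admissible : admissible_class (barreled_ptak (K := K)).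
Proof.
split; first by move=> E [].
split.
- move=> B; split; last 2 first.
  + exact: (banach_barreled KRC).
  + exact: (banach_ptak KRC).
  apply/kolmogorov_nbhs0 => x xU; apply/eqP; rewrite -normr_le0; apply/ler_addgt0Pr => e e0.
  have /xU/ltW : nbhs 0 [set y : B | `|y| < e] by apply/norm_nbhs0; exists e.
  by rewrite add0r.
- move=> E bpE A cA; apply: (@barreled_ptak_open_image _ _ (quot_map A)) => //.
  + exact: quot_map_surj.
  + exact: quot_map_continuous.
  + by move=> U /(quot_map_nbhs0 A) U0; exists (quot_map A @` U).
  + exact: tvs_quot_kolmogorov.
- move=> E F bpE [TF _ pF] u cu; have [TE bE _] := bpE.
  (* Continuity of [u] makes [graph_map] an isomorphism from [E] onto the graph. *)
  have ctu := closed_graph KRC bE pF cu.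
  apply: (@barreled_ptak_open_image _ _ (graph_map u)) => //.
  + by move=> z; exists (graph_fst z); exact: graph_fstK.
  + exact: graph_map_continuous.
  + move=> U U0; exists (@graph_fst _ _ _ u @^-1` U); last by move=> x Ux; exists x.
    by apply: graph_fst_continuous.
  + by apply: kolmogorov_sub; exact: kolmogorov_prod.
- move=> E F bpE TF u iu cu nu.
  apply: (@barreled_ptak_open_image _ _ (image_map u)) => //.
  + exact: image_map_surj.
  + exact: image_map_continuous.
  + by case: bpE => _ _ pE; apply: (image_map_open u).1; exact: (ptak_open KRC pE TF iu cu nu).
  + exact: kolmogorov_sub.
- apply: Or33 => E F [_ bE _] [TF _ pF] u; split; first exact: (closed_graph KRC bE pF).
  exact: continuous_closed_map.
Qed.

End Largest.

Theorem theorem2 (R : realType) (K : numFieldType) (KRC : real_or_complex R K) :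
  [/\ admissible_class (barreled_ptak (K := K)),
      forall C : tvs_class K, admissible_class C ->
        forall E : tvsType K, C E -> barreled_ptak E &
      forall C : tvs_class K, admissible_class C ->
        [/\ open_mapping_property C,
            continuous_inverse_property C &
            closed_graph_property C]].
Proof.
split; [exact: barreled_ptak_admissible KRC| |exact: admissible_properties].
move=> C admC E CE; have [_ CI CG] := admissible_properties admC.
have [T0 [CB Cq _ Cim _]] := admC.
split; [exact: T0|exact: (closed_graph_barreled KRC CB CG CE)|].
exact: (continuous_inverse_ptak KRC Cq Cim CI CE).
Qed.
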